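(* Let $X\in\mathcal{B}_{\mathbf{l}}^{\boldsymbol\alpha}([0,1]^d,c(\cdot))$ be a locally stationary random field, and let $X_N=X_N(X,T_N)$ be its multivariate piecewise linear interpolator, where $T_N$ is a $cRS(h,\pi,\mathbf{l})$ sequence of designs with $h=(h_1,\ldots,h_k)$ and $\pi(N)=(n_1,\ldots,n_k)$. Then $$\|X-X_N\|_2^2\lesssim\sum_{j=1}^k\frac{w_j}{n_j^{\alpha_j}}\quad\text{as }N\to\infty,$$ where $$w_j=l_j^{1+\alpha_j/2}\left(a_{\alpha_j}+\frac16\right)\int_0^1C_j(t_{L_j})\,h_j(t_{L_j})^{-\alpha_j}\,dt_{L_j},\quad j=1,\ldots,k.$$ The density minimizing $w_j$ (among positive continuous densities $h_j$ on $[0,1]$) is given by $$h_{j,subopt}(t_{L_j})=\frac{C_j(t_{L_j})^{\gamma_j}}{\int_0^1C_j(\tau_{L_j})^{\gamma_j}\,d\tau_{L_j}},\quad t_{L_j}\in[0,1],$$ where $\gamma_j:=1/(1+\alpha_j)$, $j=1,\ldots,k$. Furthermore, for these choices of densities, $w_j$ equals $$w_{j,subopt}=l_j^{1+\alpha_j/2}\left(a_{\alpha_j}+\frac16\right)\|C_j\|_{\gamma_j},\quad j=1,\ldots,k.$$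
   Context: Asymptotic notation: $u_N\lesssim v_N$ means $\limsup_{N\to\infty}u_N/v_N\le1$. Random fields: $X=X(\mathbf{t})$, $\mathbf{t}\in[0,1]^d$, is a real-valued random field with $\mathrm{E}X(\mathbf{t})^2<\infty$ for all $\mathbf{t}$. For a random variable $\xi$ put $\|\xi\|:=(\mathrm{E}\xi^2)^{1/2}$; for vectors, $\|\cdot\|$ is the Euclidean norm. $\mathcal{C}([0,1]^d)$ is the space of quadratic mean (q.m.) continuous random fields, i.e. those for which $\mathbf{t}\mapsto X(\mathbf{t})\in L^2(\Omega)$ is continuous. For a field $Y$, $\|Y\|_2:=\left(\int_{[0,1]^d}\|Y(\mathbf{t})\|^2d\mathbf{t}\right)^{1/2}$. Decomposition: $k\le d$, $\mathbf{l}=(l_1,\ldots,l_k)$ is a vector of positive integers with $\sum_{j=1}^k l_j=d$, $L_0=0$, $L_i=\sum_{j=1}^i l_j$. For $\mathbf{s}\in\mathbb{R}^d$, $\mathbf{s}^j:=(s_{L_{j-1}+1},\ldots,s_{L_j})$, $j=1,\ldots,k$. $\boldsymbol\alpha=(\alpha_1,\ldots,\alpha_k)$ with $0<\alpha_j<2$. Local stationarity: $X\in\mathcal{B}_{\mathbf{l}}^{\boldsymbol\alpha}([0,1]^d,c(\cdot))$ means that $X\in\mathcal{C}([0,1]^d)$ and, for positive continuous functions $c_1,\ldots,c_k$ on $[0,1]^d$, $c=(c_1,\ldots,c_k)$, $$\frac{\|X(\mathbf{t}+\mathbf{s})-X(\mathbf{t})\|^2}{\sum_{j=1}^k c_j(\mathbf{t})\|\mathbf{s}^j\|^{\alpha_j}}\to1\quad\text{as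 }\mathbf{s}\to0\ (\mathbf{s}\ne0,\ \mathbf{t}+\mathbf{s}\in[0,1]^d),\text{ uniformly in }\mathbf{t}\in[0,1]^d;$$ moreover each $c_j(\cdot)$ is invariant under permutations of the coordinates $t_{L_{j-1}+1},\ldots,t_{L_j}$ of the $j$-th component. The integrated local stationarity functions are $$C_j(t_{L_j}):=\int_{[0,1]^{d-1}}c_j(\mathbf{t})\,dt_1\cdots dt_{L_j-1}\,dt_{L_j+1}\cdots dt_d,\quad t_{L_j}\in[0,1],\ j=1,\ldots,k.$$ For $0<\beta<2$, $a_\beta:=\frac{2}{(\beta+1)(\beta+2)}-\frac16$. For a positive continuous function $f$ on $[0,1]$ and $\gamma>0$ (possibly $\gamma<1$), $\|f\|_\gamma:=\left(\int_0^1f(t)^\gamma dt\right)^{1/\gamma}$. Designs: $h_1,\ldots,h_k$ are positive continuous probability densities on $[0,1]$, not depending on $N$. $N$ ranges over an infinite set of positive integers, and for each such $N$, $\pi(N)=(n_1,\ldots,n_k)=(n_1(N),\ldots,n_k(N))$ is a vector of positive integers with $\prod_{j=1}^k(n_j+1)^{l_j}=N$ and $n_j(N)\to\infty$ as $N\to\infty$ for each $j$. For $i=L_{j-1}+1,\ldots,L_j$ put $h_i^*:=h_j$, $n_i^*:=n_j$. The design $T_N$ is $cRS(h,\pi,\mathbf{l})$ (cross regular sequence) if $T_N=\{\mathbf{t}_{\mathbf{i}}=(t_{1,i_1},\ldots,t_{d,i_d}):0\le i_m\le n_m^*,\ m=1,\ldots,d\}$, where $\int_0^{t_{m,i}}h_m^*(v)\,dv=i/n_m^*$,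 $i=0,\ldots,n_m^*$. Interpolator: let $*$ denote coordinatewise multiplication. For $\mathbf{i}$ with $0\le i_m\le n_m^*-1$ let $\mathbf{r}_{\mathbf{i}}=\mathbf{t}_{\mathbf{i}+(1,\ldots,1)}-\mathbf{t}_{\mathbf{i}}$ and $\mathcal{D}_{\mathbf{i}}=\{\mathbf{t}_{\mathbf{i}}+\mathbf{r}_{\mathbf{i}}*\mathbf{s}:\mathbf{s}\in[0,1]^d\}$. The multivariate piecewise linear interpolator (MPLI) is $$X_N(\mathbf{t}):=\mathrm{E}_{\boldsymbol\eta}X(\mathbf{t}_{\mathbf{i}}+\mathbf{r}_{\mathbf{i}}*\boldsymbol\eta),\quad \mathbf{t}=\mathbf{t}_{\mathbf{i}}+\mathbf{r}_{\mathbf{i}}*\mathbf{s}\in\mathcal{D}_{\mathbf{i}},$$ where $\boldsymbol\eta=(\eta_1,\ldots,\eta_d)$ has independent Bernoulli components with means $s_1,\ldots,s_d$, auxiliary to (independent of) $X$, and $\mathrm{E}_{\boldsymbol\eta}$ is expectation over $\boldsymbol\eta$ only; i.e. $X_N(\mathbf{t})=\sum_{\mathbf{e}\in\{0,1\}^d}X(\mathbf{t}_{\mathbf{i}}+\mathbf{r}_{\mathbf{i}}*\mathbf{e})\prod_{m=1}^d s_m^{e_m}(1-s_m)^{1-e_m}$. *)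

(* Defs.v *)
From HB Require Import structures.
From mathcomp Require Import all_boot all_order all_algebra perm.
From mathcomp Require Import all_classical all_reals all_analysis.

Set Implicit Arguments.
Unset Strict Implicit.
Unset Printing Implicit Defensive.

Import Order.TTheory GRing.Theory Num.Theory.
Import numFieldTopology.Exports numFieldNormedType.Exports.

Local Open Scope classical_set_scope.
Local Open Scope ring_scope.

(* Lebesgue measure on R^n, carried by n-tuples (the library's product         *)
(* sigma-algebra): the n-fold product of the one-dimensional Lebesgue measure. *)
Section lebesgue_tuple.
Context {R : realType}.
Local Notation mR := (measurableTypeR R).

Definition cons_pair n (p : mR * n.-tuple mR) : n.+1.-tuple mR :=
  [tuple of p.1 :: p.2].

Definition uncons_pair n (t : n.+1.-tuple mR) : mR * n.-tuple mR :=
  (tnth t ord0, [tuple of behead t]).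

Lemma measurable_cons_pair n : measurable_fun setT (@cons_pair n).
Proof. exact: measurable_cons. Qed.

Lemma measurable_uncons_pair n : measurable_fun setT (@uncons_pair n).
Proof.
by apply/measurable_fun_pair; [exact: measurable_tnth | exact: measurable_behead].
Qed.

Lemma cons_pairK n : cancel (@cons_pair n) (@uncons_pair n).
Proof.
move=> [x u]; rewrite /uncons_pair /cons_pair /=; congr pair.
exact: val_inj.
Qed.

Section cons_measure.
Variables (n : nat) (m : {sigma_finite_measure set (n.-tuple mR) -> \bar R}).

Definition cons_measure : set (n.+1.-tuple mR) -> \bar R :=
  pushforward (@lebesgue_measure R \x m)%E (@cons_pair n).

Let cons_measure0 : cons_measure set0 = 0%E.
Proof. by rewrite /cons_measure /pushforward preimage_set0 measure0. Qed.

Let cons_measure_ge0 A : (0 <= cons_measure A)%E.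
Proof. by rewrite /cons_measure /pushforward; exact: measure_ge0. Qed.

Let cons_measure_sigma_additive : semi_sigma_additive cons_measure.
Proof.
move=> F mF tF mUF; rewrite /cons_measure /pushforward preimage_bigcup.
apply: measure_semi_sigma_additive.
- by move=> i; rewrite -[X in measurable X]setTI; exact: measurable_cons_pair.
- apply/trivIsetP => /= i j _ _ ij; rewrite -preimage_setI.
  by move/trivIsetP : tF => /(_ _ _ _ _ ij) ->//; rewrite preimage_set0.
- rewrite -preimage_bigcup -[X in measurable X]setTI.
  exact: measurable_cons_pair.
Qed.

HB.instance Definition _ := isMeasure.Build _ _ _ cons_measure
  cons_measure0 cons_measure_ge0 cons_measure_sigma_additive.

Let cons_measure_sigma_finite : sigma_finite setT cons_measure.
Proof.
have /sigma_finiteP[F [TF ndF Foo]] := sigma_finiteT (@lebesgue_measure R).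
have /sigma_finiteP[G [TG ndG Goo]] := sigma_finiteT m.
exists (fun i => @uncons_pair n @^-1` (F i `*` G i)).
  rewrite -preimage_bigcup -(preimage_setT (@uncons_pair n)) -setXTT TF TG.
  congr (_ @^-1` _); rewrite predeqE => -[x y]; split.
    move=> [/= [i _ Fix] [j _ Gjy]]; exists (maxn i j) => //; split.
    - by move: x Fix; exact/subsetPset/ndF/leq_maxl.
    - by move: y Gjy; exact/subsetPset/ndG/leq_maxr.
  by move=> [i _ []/= ? ?]; split; exists i.
move=> i; have [mF Fioo] := Foo i; have [mG Gioo] := Goo i; split.
  rewrite -[X in measurable X]setTI; apply: measurable_uncons_pair => //.
  exact: measurableX.
rewrite /cons_measure /pushforward -comp_preimage.
rewrite (_ : uncons_pair (n:=n) \o cons_pair (n:=n) = id) ?preimage_id; last first.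
  by apply/funext => p /=; rewrite cons_pairK.
by rewrite product_measure1E// lte_mul_pinfty// ge0_fin_numE.
Qed.

HB.instance Definition _ := Measure_isSigmaFinite.Build _ _ _ cons_measure
  cons_measure_sigma_finite.

End cons_measure.

Fixpoint lebesgue_tuple n : {sigma_finite_measure set (n.-tuple mR) -> \bar R} :=
  match n with
  | 0 => @dirac _ _ ([tuple] : 0.-tuple mR) R
  | n'.+1 => cons_measure (lebesgue_tuple n')
  end.

Definition row_of_tuple n (u : n.-tuple mR) : 'rV[R]_n := \row_i tnth u i.

End lebesgue_tuple.

Section cube.
Context {R : realType}.

Definition cube n : set 'rV[R]_n := [set t | forall i, t ord0 i \in `[0, 1]].

Definition cube_integral n (f : 'rV[R]_n -> \bar R) : \bar R :=
  (\int[@lebesgue_tuple R n]_(u in [set u | cube (row_of_tuple u)])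
     f (row_of_tuple u))%E.

Definition cube_Rintegral n (f : 'rV[R]_n -> R) : R :=
  \int[@lebesgue_tuple R n]_(u in [set u | cube (row_of_tuple u)])
     f (row_of_tuple u).

Definition enorm n (s : 'rV[R]_n) : R := Num.sqrt (\sum_i s ord0 i ^+ 2).

Definition mulv n (r s : 'rV[R]_n) : 'rV[R]_n :=
  \row_i (r ord0 i * s ord0 i).

(* The point whose i-th coordinate is x and whose other coordinates are those
   of u, in order. *)
Definition insert_coord n (i : 'I_n) (x : R) (u : 'rV[R]_n.-1) : 'rV[R]_n :=
  \row_m (if unlift i m is Some m' then u ord0 m' else x).

(* Average of c over all coordinates but the i-th one, which is set to x. *)
Definition integrate_out n (c : 'rV[R]_n -> R) (i : 'I_n) (x : R) : R :=
  cube_Rintegral (fun u : 'rV[R]_n.-1 => c (insert_coord i x u)).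

Definition unit_integral (f : R -> R) : R :=
  \int[@lebesgue_measure R]_(x in `[0, 1]) f x.

Definition positive_continuous01 (f : R -> R) : Prop :=
  {within `[0, 1], continuous f} /\ {in `[0, 1], forall x, 0 < f x}.

Definition positive_continuous_density (h : R -> R) : Prop :=
  positive_continuous01 h /\ unit_integral h = 1.

(* ||f||_gamma for f > 0, with gamma > 0 possibly less than 1. *)
Definition gamma_norm (gamma : R) (f : R -> R) : R :=
  unit_integral (fun x => f x `^ gamma) `^ gamma^-1.

End cube.

(* The d = \sum_j l j coordinates are split into k consecutive blocks, the j-th
   of length l j.  The coordinate m of block j is [tagnat.Rank j m], that is
   l 0 + ... + l j.-1 + m, and the block of a coordinate i is [tagnat.sig1 i]. *)
Section blocks.
Variables (k : nat) (l : 'I_k -> nat).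

Definition tdim : nat := (\sum_j l j)%N.

Definition block_of (i : 'I_tdim) : 'I_k := tagnat.sig1 i.

Definition block (j : 'I_k) : {set 'I_tdim} := [set i | block_of i == j]%SET.

Definition subvector (R : realType) (s : 'rV[R]_tdim) (j : 'I_k) : 'rV[R]_(l j) :=
  \row_m s ord0 (tagnat.Rank j m).

Lemma last_in_block (j : 'I_k) : (0 < l j)%N -> ((l j).-1 < l j)%N.
Proof. by rewrite ltn_predL. Qed.

(* The coordinate numbered L_j = l_1 + ... + l_j when counting from 1. *)
Definition last_coord (l_gt0 : forall j, (0 < l j)%N) (j : 'I_k) : 'I_tdim :=
  tagnat.Rank j (Ordinal (last_in_block (l_gt0 j))).

End blocks.

Section random_fields.
Context {R : realType} {dO : measure_display} {Omega : measurableType dO}.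
Variable P : probability Omega R.

(* The norm ||xi|| = (E xi^2)^(1/2), in [0, +oo]. *)
Definition rv_norm (xi : Omega -> R) : \bar R :=
  ('E_P[fun w => (xi w ^+ 2)%R] `^ 2^-1)%E.

(* The norm ||Y||_2 = (int_{[0,1]^n} ||Y(t)||^2 dt)^(1/2), in [0, +oo]. *)
Definition field_norm n (Y : 'rV[R]_n -> Omega -> R) : \bar R :=
  (cube_integral (fun t => rv_norm (Y t) ^+ 2) `^ 2^-1)%E.

(* Fields on [0,1]^n are total functions whose values outside the cube are
   irrelevant. *)
Definition second_order_field n (X : 'rV[R]_n -> Omega -> R) : Prop :=
  forall t, cube t ->
    measurable_fun setT (X t) /\ ('E_P[fun w => (X t w ^+ 2)%R] < +oo)%E.

Definition qm_continuous n (X : 'rV[R]_n -> Omega -> R) : Prop :=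
  forall t, cube t ->
    rv_norm (fun w => X u w - X t w) @[u --> within (@cube R n) (nbhs t)] --> 0%E.

Definition locally_stationary k (l : 'I_k -> nat) (alpha : 'I_k -> R)
    (c : 'I_k -> 'rV[R]_(tdim l) -> R) (X : 'rV[R]_(tdim l) -> Omega -> R) : Prop :=
  [/\ second_order_field X /\ qm_continuous X,
      forall j, {within @cube R (tdim l), continuous (c j)} /\
                (forall t, cube t -> 0 < c j t),
      forall eps : R, 0 < eps -> exists2 delta : R, 0 < delta &
        forall t s, cube t -> s != 0 -> cube (t + s) -> enorm s < delta ->
        (`| rv_norm (fun w => (X (t + s) w - X t w)%R) ^+ 2
            / (\sum_j c j t * enorm (subvector s j) `^ alpha j)%R%:E - 1 |
         < eps%:E)%E
    & forall j (sigma : {perm 'I_(tdim l)}), perm_on (block l j) sigma ->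
        forall t, cube t -> c j (col_perm sigma t) = c j t].

End random_fields.

Section interpolation.
Context {R : realType}.

(* The i-th of the n + 1 knots of the regular sequence generated by h: the
   point x of [0,1] with int_0^x h = i / n, unique as h > 0. *)
Definition rs_knot (h : R -> R) (n i : nat) : R :=
  xget 0 [set x | x \in `[0, 1] /\
    \int[@lebesgue_measure R]_(v in `[0, x]) h v = i%:R / n%:R].

(* t_(m,i) for the cross regular sequence cRS(h, n, l): coordinate m uses the
   density and the size of its block. *)
Definition crs_knot k (l : 'I_k -> nat) (h : 'I_k -> R -> R) (n : 'I_k -> nat)
    (m : 'I_(tdim l)) (i : nat) : R :=
  rs_knot (h (block_of m)) (n (block_of m)) i.

Definition grid_point d (T : 'I_d -> nat -> R) (i : {ffun 'I_d -> nat}) :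
    'rV[R]_d := \row_m T m (i m).

Definition cell_side d (T : 'I_d -> nat -> R) (i : {ffun 'I_d -> nat}) :
    'rV[R]_d := grid_point T [ffun m => (i m).+1] - grid_point T i.

(* (i, s) such that i indexes a cell containing t and t = t_i + r_i * s.  When
   t lies on a face shared by several cells, all choices give the same value
   of the interpolator. *)
Definition cell_coords d (T : 'I_d -> nat -> R) (n : 'I_d -> nat) (t : 'rV[R]_d) :
    {ffun 'I_d -> nat} * 'rV[R]_d :=
  xget ([ffun=> 0%N], 0)
    [set p : {ffun 'I_d -> nat} * 'rV[R]_d | [/\ forall m, (p.1 m < n m)%N, cube p.2 &
    t = grid_point T p.1 + mulv (cell_side T p.1) p.2]].

(* Expectation of X (t_i + r_i * eta) over independent Bernoulli eta_m with
   means s_m, written out over the values e of eta. *)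
Definition mpli d (T : 'I_d -> nat -> R) (n : 'I_d -> nat) (Omega : Type)
    (X : 'rV[R]_d -> Omega -> R) (t : 'rV[R]_d) (w : Omega) : R :=
  let: (i, s) := cell_coords T n t in
  \sum_(e : {ffun 'I_d -> bool})
    X (grid_point T i + mulv (cell_side T i) (\row_m (e m)%:R)) w *
    \prod_m (s ord0 m ^+ e m * (1 - s ord0 m) ^+ (~~ e m)).

Definition crs_mpli k (l : 'I_k -> nat) (h : 'I_k -> R -> R) (n : 'I_k -> nat)
    (Omega : Type) (X : 'rV[R]_(tdim l) -> Omega -> R) :
    'rV[R]_(tdim l) -> Omega -> R :=
  mpli (crs_knot (l := l) h n) (fun m => n (block_of m)) X.

End interpolation.

(* N ranges over the infinite set A and nn N = (n_1(N), ..., n_k(N)). *)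
Definition design_sizes k (l : 'I_k -> nat) (A : set nat)
    (nn : nat -> 'I_k -> nat) : Prop :=
  [/\ infinite_set A,
      forall N, A N -> (0 < N)%N /\ (forall j, 0 < nn N j)%N,
      forall N, A N -> (\prod_j (nn N j).+1 ^ l j)%N = N
    & forall j, nn N j @[N --> within A \oo] --> \oo].

(* u_N <~ v_N, that is limsup u_N / v_N <= 1, as N -> oo in A. *)
Definition asymp_le (R : realType) (A : set nat) (u : nat -> \bar R)
    (v : nat -> R) : Prop :=
  (limf_esup (fun N => u N / (v N)%:E) (within A \oo) <= 1)%E.

Section constants.
Context {R : realType} (k : nat) (l : 'I_k -> nat).
Variable l_gt0 : forall j, (0 < l j)%N.
Variables (alpha : 'I_k -> R) (c : 'I_k -> 'rV[R]_(tdim l) -> R).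

Definition a_const (b : R) : R := 2 / ((b + 1) * (b + 2)) - 1 / 6.

(* C_j(t_(L_j)). *)
Definition Cint (j : 'I_k) (x : R) : R := integrate_out (c j) (last_coord l_gt0 j) x.

Definition wfactor (j : 'I_k) : R :=
  (l j)%:R `^ (1 + alpha j / 2) * (a_const (alpha j) + 1 / 6).

Definition w_coef (j : 'I_k) (h : R -> R) : R :=
  wfactor j * unit_integral (fun x => Cint j x * h x `^ (- alpha j)).

Definition gamma_exp (j : 'I_k) : R := 1 / (1 + alpha j).

Definition h_subopt (j : 'I_k) (x : R) : R :=
  Cint j x `^ gamma_exp j / unit_integral (fun y => Cint j y `^ gamma_exp j).

Definition w_subopt (j : 'I_k) : R := wfactor j * gamma_norm (gamma_exp j) (Cint j).

End constants.

(* Main.v *)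
Require Import Defs.
From HB Require Import structures.
From mathcomp Require Import all_boot all_order all_algebra perm.
From mathcomp Require Import all_classical all_reals all_analysis.
From mathcomp Require Import measurable_realfun lra ring.

Set Implicit Arguments.
Unset Strict Implicit.
Unset Printing Implicit Defensive.

Import Order.TTheory GRing.Theory Num.Theory.
Import numFieldTopology.Exports numFieldNormedType.Exports.

Local Open Scope classical_set_scope.
Local Open Scope ring_scope.

(** If [t] lies in the cell with lower corner [t_i] and sides [r_i], then the
    interpolator is the mean of [X (t_i + r_i * eta)] over independent Bernoulli
    variables [eta_m] whose means are the local coordinates [s_m] of [t].  Since
    the square is convex, [||X t - X_N t||^2] is at most the mean of
    [||X t - X (t_i + r_i * eta)||^2] ([rv_norm_sub_mean_le]).  Once the cells
    are small, local stationarity bounds each of these by [1 + eps] times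
    [\sum_j c_j t * |(r_i * (eta - s))^j| ^ alpha_j].  In a block of length [l]
    the Euclidean norm satisfies [|v| ^ a <= l ^ (a / 2) * \sum_m |v_m| ^ a]
    ([enorm_powR_le]).  These two inequalities are not sharp, so that only an
    upper bound results.  What is left is a sum of functions of a single coordinate, the
    two-point moments [E |r_m (eta_m - s_m)| ^ a] ([mpli_pointwise_bound]).

    Integrating over the cube, Fubini turns the weight [c_j t] of a function of
    [t_m] into the integral of [c_j] over the other coordinates
    ([cube_integral_coord]).  Because [c_j] is symmetric in the coordinates of
    block [j], all coordinates of the block give the same function [C_j]
    ([integrate_out_block]), whence one more factor [l_j].  On a cell [[a, b]] of
    a one-dimensional regular sequence the integral of the two-point moment is
    [2 / ((alpha + 1) (alpha + 2)) * (b - a) ^ (alpha + 1)]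
    ([integral_two_point_moment]), the length [b - a] is close to [1 / (n h)] as
    the cell has mass [1 / n], and [C_j] is almost constant, all uniformly in the
    cell.  The sum over the cells is therefore at most [1 + eps] times
    [2 / ((alpha + 1) (alpha + 2)) * n ^ (- alpha) * \int C_j h ^ (- alpha)]
    ([cell_moment_asymptotics]).

    For the optimal density [h], proportional to [C ^ (1 / (1 + alpha))], one has
    [C = M ^ (1 + alpha) * h ^ (1 + alpha)], so that for another density [g] the
    functional is [M ^ (1 + alpha) * \int h (g / h) ^ (- alpha)].  The tangent
    at 1 to the convex function [y ^ (- alpha)] gives the lower bound
    [M ^ (1 + alpha) * \int ((1 + alpha) h - alpha g) = M ^ (1 + alpha)], with
    equality only where [g = h] ([optimal_weight_le],
    [optimal_weight_unique]). *)

(** * Iterated integrals over tuples *)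

Section tuple_fubini.
Context {R : realType}.
Local Notation mR := (measurableTypeR R).
Local Notation mu := (@lebesgue_measure R).
Local Notation row n := (@row_of_tuple R n).

(** For a function on rows, measurability means measurability along
    [row_of_tuple]; a map into rows respects it when its coordinates are
    measurable. *)
Lemma measurable_comp_row d (T : measurableType d) n (F : 'rV[R]_n -> \bar R)
    (g : T -> 'rV[R]_n) :
  measurable_fun setT (fun u : n.-tuple mR => F (row_of_tuple u)) ->
  (forall i, measurable_fun setT (fun t => g t ord0 i : mR)) ->
  measurable_fun setT (fun t => F (g t)).
Proof.
move=> mF mg.
have -> : (fun t => F (g t)) =
    (fun u => F (row n u)) \o (fun t => [tuple (g t ord0 i : mR) | i < n]).
  apply/funext => t /=; congr F; apply/rowP => i.
  by rewrite mxE tnth_mktuple.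
apply: measurableT_comp => //; apply/measurable_fun_tnthP => i.
rewrite (_ : _ \o _ = fun t => g t ord0 i) //.
by apply/funext => t /=; rewrite tnth_mktuple.
Qed.

Lemma insert_coord_same n (i : 'I_n) (x : R) u : insert_coord i x u ord0 i = x.
Proof. by rewrite mxE unlift_none. Qed.

Lemma insert_coord_lift n (i : 'I_n) (x : R) u j :
  insert_coord i x u ord0 (lift i j) = u ord0 j.
Proof. by rewrite mxE liftK. Qed.

Lemma measurable_insert_coord d (T : measurableType d) n (i : 'I_n)
    (f : T -> mR) (g : T -> 'rV[R]_n.-1) :
  measurable_fun setT f ->
  (forall j, measurable_fun setT (fun t => g t ord0 j : mR)) ->
  forall j, measurable_fun setT (fun t => insert_coord i (f t) (g t) ord0 j : mR).
Proof.
move=> mf mg j; case: (unliftP i j) => [j' ->|->].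
  rewrite (_ : (fun t => _) = (fun t => g t ord0 j'))//.
  by apply/funext => t; rewrite insert_coord_lift.
rewrite (_ : (fun t => _) = f)//.
by apply/funext => t; rewrite insert_coord_same.
Qed.

Lemma measurable_row_coord n (j : 'I_n) :
  measurable_fun setT (fun u : n.-tuple mR => row_of_tuple u ord0 j : mR).
Proof.
rewrite (_ : (fun u => _) = (@tnth n mR ^~ j)); first exact: measurable_tnth.
by apply/funext => u; rewrite mxE.
Qed.

Local Lemma integral_insert_coord0 n (F : 'rV[R]_n.+1 -> \bar R) :
  measurable_fun setT (fun u : n.+1.-tuple mR => F (row_of_tuple u)) ->
  (forall t, 0 <= F t)%E ->
  (\int[lebesgue_tuple n.+1]_u F (row_of_tuple u) =
   \int[mu]_x \int[lebesgue_tuple n]_v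
      F (insert_coord (ord0 : 'I_n.+1) x (row_of_tuple v)))%E.
Proof.
move=> mF F0.
transitivity (\int[pushforward (mu \x lebesgue_tuple n)%E (@cons_pair R n)]_u
   F (row_of_tuple u))%E; first by [].
rewrite ge0_integral_pushforward//; last exact: measurable_cons_pair.
rewrite preimage_setT.
transitivity (\int[mu \x lebesgue_tuple n]_p
   (F (insert_coord (ord0 : 'I_n.+1) p.1 (row_of_tuple p.2))))%E.
  apply: eq_integral => -[x u] _ /=; congr F; apply/rowP => j.
  case: (unliftP ord0 j) => [j' ->|->].
    by rewrite insert_coord_lift !mxE tnthS.
  by rewrite insert_coord_same !mxE.
rewrite fubini_tonelli1//.
apply: measurable_comp_row => //.
apply: measurable_insert_coord => // j.
apply: (measurableT_comp (measurable_row_coord j)) => //.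
Qed.

(** The measure on tuples is built by adding coordinates in front, so only the
    first coordinate can be split off by definition.  Any other one is reached by
    induction: split off the first coordinate, apply the hypothesis to the rest,
    and exchange the two outer integrals. *)
Lemma integral_insert_coord n (m : 'I_n.+1) (F : 'rV[R]_n.+1 -> \bar R) :
  measurable_fun setT (fun u : n.+1.-tuple mR => F (row_of_tuple u)) ->
  (forall t, 0 <= F t)%E ->
  (\int[lebesgue_tuple n.+1]_u F (row_of_tuple u) =
   \int[mu]_x \int[lebesgue_tuple n]_v F (insert_coord m x (row_of_tuple v)))%E.
Proof.
elim: n m F => [|n IH] m F mF F0; first by rewrite ord1; exact: integral_insert_coord0.
case: (unliftP ord0 m) => [m' ->|->]; last exact: integral_insert_coord0.
apply: etrans (integral_insert_coord0 mF F0) _.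
(* The two coordinates split off and the remaining ones, as one product, so that
   measurability of the inner integral is part of Tonelli's theorem. *)
pose F3 (p : (mR * mR) * n.-tuple mR) : \bar R :=
  F (insert_coord (ord0 : 'I_n.+2) p.1.1 (insert_coord m' p.1.2 (row_of_tuple p.2))).
have mF3 : measurable_fun setT F3.
  apply: measurable_comp_row => //.
  apply: measurable_insert_coord.
    exact: (measurableT_comp measurable_fst).
  apply: measurable_insert_coord.
    exact: (measurableT_comp measurable_snd).
  by move=> j; apply: (measurableT_comp (measurable_row_coord j)).
transitivity (\int[mu]_x \int[mu]_y \int[lebesgue_tuple n]_w F3 ((x, y), w))%E.
  apply: eq_integral => x _.
  rewrite (IH m' (fun t => F (insert_coord (ord0 : 'I_n.+2) x t)))//.
  apply: measurable_comp_row => //; apply: measurable_insert_coord => //.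
  by move=> j; exact: measurable_row_coord.
rewrite (fubini_tonelli (fun z => \int[lebesgue_tuple n]_w F3 (z, w)))%E//; first last.
- by move=> z; apply: integral_ge0 => w _; exact: F0.
- apply: (measurable_fun_fubini_tonelli_F F3) => //.
  by move=> z; exact: F0.
apply: eq_integral => y _.
pose G t := F (insert_coord (lift ord0 m') y t).
have mG : measurable_fun setT (fun v : n.+1.-tuple mR => G (row_of_tuple v)).
  apply: (measurable_comp_row (F := F)) => //; apply: measurable_insert_coord => //.
  by move=> j; exact: measurable_row_coord.
apply: etrans _ (esym (integral_insert_coord0 mG (fun t => F0 _))).
apply: eq_integral => x _; apply: eq_integral => w _; rewrite /F3 /=; congr F.
apply/rowP => j; case: (unliftP (lift ord0 m') j) => [j' ->|->].
  rewrite insert_coord_lift; case: (unliftP ord0 j') => [j2 ->|->].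
    rewrite (_ : lift (lift ord0 m') (lift ord0 j2) = lift ord0 (lift m' j2)).
      by rewrite !insert_coord_lift.
    by apply/val_inj => /=; rewrite bumpS.
  rewrite insert_coord_same (_ : lift (lift ord0 m') ord0 = ord0).
    by rewrite insert_coord_same.
  exact/val_inj.
by rewrite insert_coord_same insert_coord_lift insert_coord_same.
Qed.

End tuple_fubini.

(** * Continuous functions on compact sets *)

Section compact_continuous.
Context {R : realType} {T : pseudoMetricType R} (A : set T) (f : T -> R).

Lemma within_continuousP :
  {within A, continuous f} <->
  forall x, A x -> forall e, 0 < e -> exists2 d : R, 0 < d &
    forall y, A y -> ball x d y -> `|f x - f y| < e.
Proof.
split.
  move=> /subspace_continuousP cf x Ax e e0.
  have /cvgrPdist_lt/(_ _ e0) := cf _ Ax.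
  rewrite near_withinE => /nbhs_ballP[d /= d0 H]; exists d => // y Ay xy.
  exact: H.
move=> H; apply/subspace_continuousP => x Ax.
apply/cvgrPdist_lt => e e0; rewrite near_withinE.
have [d d0 xd] := H _ Ax _ e0; apply/nbhs_ballP; exists d => //= y xy Ay.
exact: xd.
Qed.

(** The Heine-Cantor theorem for the subspace topology, by a near-covering
    argument at [0^'+]. *)
Lemma compact_uniform_continuous : compact A -> {within A, continuous f} ->
  forall e, 0 < e -> exists2 d : R, 0 < d &
    forall x y, A x -> A y -> ball x d y -> `|f x - f y| < e.
Proof.
move=> cA /within_continuousP cf e e0.
pose P (d : R) x := forall y, A y -> ball x d y -> `|f x - f y| < e.
have H : \forall d \near 0^'+, A `<=` P d.
  move/compact_near_coveringP/near_covering_withinP : cA; apply => x Ax.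
  have [d d0 xd] := cf _ Ax _ (divr_gt0 e0 (@ltr0Sn R 1)).
  near=> x' r => Ax' y Ay x'y.
  have xx' : ball x (d / 2) x' by near: x'; apply: nbhsx_ballx; rewrite divr_gt0.
  have rd : r < d / 2 by near: r; apply: nbhs_right_lt; rewrite divr_gt0.
  have xy : ball x d y.
    rewrite (splitr d); apply: ball_triangle xx' _.
    by apply: le_ball x'y; exact: ltW.
  have xx'd : ball x d x'.
    by apply: le_ball xx'; lra.
  rewrite (_ : f x' - f y = (f x - f y) - (f x - f x')); last by ring.
  rewrite (le_lt_trans (ler_normB _ _))// (splitr e) ltrD//; exact: xd.
have [d [d0 Hd]] : exists d : R, 0 < d /\ A `<=` P d.
  apply: (@filter_ex _ (0 : R)^'+).
  near=> d; split; first by near: d; exact: nbhs_right_gt.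
  by near: d; exact: H.
by exists d => // x y Ax Ay; exact: Hd.
Unshelve. all: by end_near. Qed.

End compact_continuous.

Section positive_compact.
Context {R : realType} {T : pseudoMetricType R} (A : set T) (f : T -> R).
Hypotheses (cA : compact A) (cf : {within A, continuous f}).

Lemma compact_upper_bound : exists2 M : R, 0 < M & forall x, A x -> f x <= M.
Proof.
have [->|/set0P A0] := eqVneq A set0; first by exists 1.
have [c /set_mem Ac H] := compact_EVT_max A0 cA cf.
exists (Num.max 1 (f c)); first by rewrite lt_max ltr01.
by move=> x Ax; rewrite le_max (H x (mem_set Ax)) orbT.
Qed.

Hypothesis f0 : forall x, A x -> 0 < f x.

Lemma compact_lower_bound : exists2 m : R, 0 < m & forall x, A x -> m <= f x.
Proof.
have [->|/set0P A0] := eqVneq A set0; first by exists 1.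
have [c /set_mem Ac H] := compact_EVT_min A0 cA cf.
by exists (f c); [exact: f0|move=> x Ax; apply: H; rewrite inE].
Qed.

(** A positive continuous function is bounded below on a compact set, so a small
    absolute variation is a small relative one.  All the error terms below are
    relative, since they have to be absorbed in a factor [1 + e]. *)
Lemma compact_ratio (e : R) : 0 < e -> exists2 d : R, 0 < d &
  forall x y, A x -> A y -> ball x d y -> f x <= (1 + e) * f y.
Proof.
move=> e0; have [m m0 mf] := compact_lower_bound.
have [d d0 H] := compact_uniform_continuous cA cf (mulr_gt0 e0 m0).
exists d => // x y Ax Ay xy; have := ltW (H _ _ Ax Ay xy).
have : e * m <= e * f y by rewrite ler_pM2l// mf.
by rewrite ler_norml => ? /andP[_]; lra.
Qed.

End positive_compact.

(** * The unit cube *)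

Section cube_facts.
Context {R : realType}.
Local Notation mR := (measurableTypeR R).
Local Notation mu := (@lebesgue_measure R).

Lemma in_itv01 (x : R) : (x \in `[0, 1]) = (0 <= x <= 1).
Proof. by rewrite in_itv. Qed.

Lemma compact_cube n : compact (@cube R n).
Proof. exact: (rV_compact (fun=> @segment_compact R 0 1)). Qed.

Lemma ball_rowP n (x y : 'rV[R]_n) (e : R) : 0 < e ->
  (forall i, `|x ord0 i - y ord0 i| < e) -> ball x e y.
Proof. by move=> e0 H; split => // i j; rewrite ord1; exact: H. Qed.

Definition cube_tuple n : set (n.-tuple mR) := [set u | cube (row_of_tuple u)].

Lemma measurable_cube_tuple n : measurable (@cube_tuple n).
Proof.
rewrite (_ : cube_tuple (n:=n) =
    \bigcap_(i in [set: 'I_n]) ((fun u : n.-tuple mR => row_of_tuple u ord0 i) @^-1` `[0, 1])).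
  apply: fin_bigcap_measurable => [|i _]; first exact: finite_finset.
  rewrite -[X in measurable X]setTI.
  by apply: measurable_row_coord => //; exact: measurable_itv.
by apply/seteqP; split => [u H i _|u H i]; [exact: H|exact: H].
Qed.

Lemma cube_insert_coord n (m : 'I_n.+1) (x : R) (u : 'rV[R]_n) :
  cube (insert_coord m x u) <-> x \in `[0, 1] /\ cube u.
Proof.
split=> [H|[Hx Hu] j].
  by split=> [|j]; [have := H m|have := H (lift m j)];
    rewrite (insert_coord_same, insert_coord_lift).
by case: (unliftP m j) => [j' ->|->]; rewrite (insert_coord_same, insert_coord_lift).
Qed.

(** The sigma-algebra on tuples is generated by the coordinates and not by a
    topology, so continuity says nothing about it directly.  But [f] is the
    pointwise limit of the step functions that
    evaluate it at the point with coordinates [floor (N u_m) / N]. *)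
Lemma measurable_cube_continuous n (f : 'rV[R]_n -> R) :
  {within @cube R n, continuous f} ->
  measurable_fun (@cube_tuple n) (fun u => f (row_of_tuple u)).
Proof.
move=> cf.
pose I N (i : 'I_N.+2) : set mR := `[i%:R / N.+1%:R, i.+1%:R / N.+1%:R[%classic.
pose pt N (i : {ffun 'I_n -> 'I_N.+2}) : 'rV[R]_n := \row_m ((i m)%:R / N.+1%:R).
pose g N (u : n.-tuple mR) := \sum_(i : {ffun 'I_n -> 'I_N.+2})
  f (pt N i) * \prod_m \1_(I N (i m)) (row_of_tuple u ord0 m).
apply: (measurable_fun_cvg (h := g)) => [N|u uc].
  apply: measurable_funTS; apply: measurable_sum => i.
  apply: measurable_funM; first exact: measurable_cst.
  apply: measurable_prod => m _.
  have mI : measurable_fun setT (\1_(I N (i m)) : mR -> R).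
    by apply: measurable_indic; exact: measurable_itv.
  exact: (measurableT_comp mI (measurable_row_coord m)).
apply/cvgrPdist_lt => e e0.
have [d d0 Hd] := compact_uniform_continuous (@compact_cube n) cf e0.
near=> N; rewrite /g.
have N0 : 0 < N.+1%:R :> R by rewrite ltr0n.
have tr m : (Num.truncn (row_of_tuple u ord0 m * N.+1%:R) < N.+2)%N.
  have := uc m; rewrite in_itv01 => /andP[u0 u1].
  by rewrite ltnS truncn_le_nat (le_lt_trans (y := N.+1%:R))// ?ltr_nat// ler_piMl// ler0n.
pose i0 := [ffun m => Ordinal (tr m)].
have i0P m : (i0 m)%:R / N.+1%:R <= row_of_tuple u ord0 m < (i0 m).+1%:R / N.+1%:R.
  rewrite ffunE ler_pdivrMr// ltr_pdivlMr//; apply: truncn_itv.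
  by have := uc m; rewrite in_itv01 => /andP[u0 u1]; rewrite mulr_ge0// ler0n.
rewrite (bigD1 i0)//= [X in _ * X]big1 => [|m _]; last first.
  by rewrite indicE mem_set// /I /= in_itv /=.
rewrite mulr1 [X in _ - (_ + X)]big1 ?addr0 => [|i ii0]; last first.
  have [m im] : exists m, i m != i0 m.
    apply/existsP; rewrite -negb_forall; apply: contra ii0 => /forallP H.
    by apply/eqP/ffunP => m; apply/eqP.
  rewrite (bigD1 m)//= indicE memNset ?mul0r ?mulr0// /I /= in_itv /=.
  apply/negP; apply: contra im; rewrite ler_pdivrMr// ltr_pdivlMr// => H.
  by apply/eqP/val_inj; rewrite /= /i0 ffunE /=; apply/esym/truncn_def.
apply: Hd => //.
  move=> m; rewrite mxE in_itv01 divr_ge0//= ler_pdivrMr// mul1r ler_nat.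
  by rewrite -ltnS.
apply: ball_rowP => // m; rewrite [X in _ - X]mxE.
have /andP[l r] := i0P m; rewrite ger0_norm ?subr_ge0//.
move: r; rewrite -(addn1 (i0 m)) natrD mulrDl => r.
rewrite ltrBlDl (lt_le_trans r)// lerD2l mul1r ltW//.
by near: N; exact: near_infty_natSinv_lt (PosNum d0).
Unshelve. all: by end_near. Qed.

End cube_facts.

(** * Integrating out one coordinate *)

Section cube_integrals.
Context {R : realType}.
Local Notation mR := (measurableTypeR R).
Local Notation mu := (@lebesgue_measure R).

(** [integral_insert_coord] for a function extended by 0 outside of the cube. *)
Lemma cube_fubini n (m : 'I_n.+1) (F : 'rV[R]_n.+1 -> \bar R) :
  measurable_fun (@cube_tuple R n.+1) (fun u => F (row_of_tuple u)) ->
  (forall t, cube t -> 0 <= F t)%E ->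
  (\int[lebesgue_tuple n.+1]_(u in @cube_tuple R n.+1) F (row_of_tuple u) =
   \int[mu]_(x in `[0%R, 1%R]) \int[lebesgue_tuple n]_(v in @cube_tuple R n)
      F (insert_coord m x (row_of_tuple v)))%E.
Proof.
move=> mF F0; rewrite integral_mkcond.
have FE p : (F \o row_of_tuple (n:=n.+1)) \_ (@cube_tuple R n.+1) p =
    (F \_ (@cube R n.+1)) (row_of_tuple p).
  by rewrite !patchE.
rewrite (eq_integral (fun p => (F \_ (@cube R n.+1)) (row_of_tuple p)))//.
rewrite (integral_insert_coord m (F := F \_ (@cube R n.+1))); last 2 first.
- move/(measurable_restrictT _ (@measurable_cube_tuple R n.+1)) : mF.
  by apply: eq_measurable_fun => p _; rewrite -FE.
- by move=> t; rewrite patchE; case: ifPn => // /set_mem; exact: F0.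
rewrite [RHS]integral_mkcond; apply: eq_integral => x _; rewrite [RHS]patchE.
case: ifPn => [/set_mem /= x01|/negP x01].
  rewrite [RHS]integral_mkcond; apply: eq_integral => v _; rewrite !patchE.
  by congr (if _ then _ else _); apply/idP/idP => /set_mem H; apply/mem_set;
    [have [] := (cube_insert_coord m x (row_of_tuple v)).1 H|
     exact/(cube_insert_coord m x (row_of_tuple v)).2].
apply: integral0_eq => v _; rewrite patchE memNset// => /cube_insert_coord[].
by move=> ? _; apply: x01; apply/mem_set.
Qed.

Lemma lebesgue_itv01 : mu `[0%R, 1%R]%classic = 1%E.
Proof. by rewrite lebesgue_measure_itv/= lte01 oppr0 adde0. Qed.

Lemma lebesgue_cube n : lebesgue_tuple n (@cube_tuple R n) = 1%E.
Proof.
elim: n => [|n IH].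
  by rewrite /= diracE mem_set// => -[].
rewrite -[LHS]mul1e -integral_cst; last exact: measurable_cube_tuple.
rewrite (cube_fubini ord0 (F := cst 1%E))//.
rewrite (eq_integral (cst 1%E)) => [|x _].
  by rewrite integral_cst// mul1e; exact: lebesgue_itv01.
by rewrite integral_cst ?mul1e//; exact: measurable_cube_tuple.
Qed.

Section integrate_out.
Variables (n : nat) (m : 'I_n.+1) (c : 'rV[R]_n.+1 -> R).
Hypotheses (cc : {within @cube R n.+1, continuous c})
  (c0 : forall t, cube t -> 0 < c t).

Lemma continuous_insert_coord x : x \in `[0, 1] ->
  {within @cube R n, continuous (fun u => c (insert_coord m x u))}.
Proof.
move=> x01; apply/within_continuousP => u uc e e0.
have [d d0 H] := (within_continuousP _ _).1 cc _
  ((cube_insert_coord m x u).2 (conj x01 uc)) _ e0.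
exists d => // v vc uv; apply: H; first exact/cube_insert_coord.
apply: ball_rowP => // j; case: (unliftP m j) => [j' ->|->].
  by rewrite !insert_coord_lift; case: uv => _ /(_ ord0 j').
by rewrite !insert_coord_same subrr normr0.
Qed.

Lemma integrable_insert_coord x : x \in `[0, 1] ->
  (lebesgue_tuple n).-integrable (@cube_tuple R n)
    (EFin \o (fun v => c (insert_coord m x (row_of_tuple v)))).
Proof.
move=> x01; apply: measurable_bounded_integrable.
- exact: measurable_cube_tuple.
- by rewrite [X in (X < _)%E]lebesgue_cube ltry.
- exact: measurable_cube_continuous (continuous_insert_coord x01).
have [M M0 H] := compact_upper_bound (@compact_cube R n.+1) cc.
exists M; split; first exact: gtr0_real.
move=> B MB u uc /=; have uc' := (cube_insert_coord m x (row_of_tuple u)).2 (conj x01 uc).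
by rewrite gtr0_norm ?(le_trans (H _ uc') (ltW MB))//; exact: c0.
Qed.

Lemma integrate_outE x : x \in `[0, 1] -> (integrate_out c m x)%:E =
  (\int[lebesgue_tuple n]_(v in @cube_tuple R n)
     (c (insert_coord m x (row_of_tuple v)))%:E)%E.
Proof.
move=> x01; rewrite /integrate_out /cube_Rintegral /Rintegral fineK//.
apply: integrable_fin_num; first exact: measurable_cube_tuple.
exact: integrable_insert_coord.
Qed.

Lemma integrate_out_gt0 x : x \in `[0, 1] -> 0 < integrate_out c m x.
Proof.
move=> x01; have [b b0 H] := compact_lower_bound (@compact_cube R n.+1) cc c0.
rewrite (lt_le_trans b0)// -lee_fin integrate_outE//.
rewrite -[leLHS]mule1 -(lebesgue_cube n) -integral_cst; last exact: measurable_cube_tuple.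
apply: ge0_le_integral => //.
- exact: measurable_cube_tuple.
- by move=> v _; rewrite lee_fin ltW.
- by case/integrableP: (integrable_insert_coord x01).
- by move=> v vc; rewrite lee_fin H//; exact/cube_insert_coord.
Qed.

(** Uniform continuity of [c] bounds the variation of the integrand uniformly in
    the other coordinates, and the cube has measure 1. *)
Lemma integrate_out_continuous : {within `[0, 1], continuous (integrate_out c m)}.
Proof.
have key e : 0 < e -> exists2 d : R, 0 < d & forall x y, x \in `[0, 1] ->
    y \in `[0, 1] -> `|x - y| < d -> integrate_out c m x <= integrate_out c m y + e.
  move=> e0; have [d d0 H] := compact_uniform_continuous (@compact_cube R n.+1) cc e0.
  exists d => // x y x01 y01 xy; rewrite -lee_fin EFinD !integrate_outE//.
  rewrite -[e%:E]mule1 -(lebesgue_cube n) -integral_cst; last exact: measurable_cube_tuple.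
  rewrite -ge0_integralD//=; first last.
  - by move=> v _; rewrite lee_fin ltW.
  - by case/integrableP: (integrable_insert_coord y01).
  - by move=> v vc; rewrite lee_fin ltW// c0//; exact/cube_insert_coord.
  - exact: measurable_cube_tuple.
  apply: ge0_le_integral => //.
  - exact: measurable_cube_tuple.
  - by move=> v vc; rewrite lee_fin ltW// c0//; exact/cube_insert_coord.
  - by case/integrableP: (integrable_insert_coord x01).
  - by apply: emeasurable_funD => //; case/integrableP: (integrable_insert_coord y01).
  move=> v vc; rewrite -EFinD lee_fin.
  have b : ball (insert_coord m x (row_of_tuple v)) d (insert_coord m y (row_of_tuple v)).
    apply: ball_rowP => // j; case: (unliftP m j) => [j' ->|->].
      by rewrite !insert_coord_lift subrr normr0.
    by rewrite !insert_coord_same.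
  have /ltW := H _ _ ((cube_insert_coord m x (row_of_tuple v)).2 (conj x01 vc))
    ((cube_insert_coord m y (row_of_tuple v)).2 (conj y01 vc)) b.
  by rewrite ler_norml lerBlDl => /andP[_].
apply/within_continuousP => x x01 e e0.
have [d d0 H] := key _ (divr_gt0 e0 (@ltr0Sn R 1)).
exists d => // y y01 xy.
have yx : `|y - x| < d by rewrite distrC.
have h1 := H x y x01 y01 xy; have h2 := H y x y01 x01 yx.
by rewrite ltr_norml; lra.
Qed.

(** The function of the selected coordinate is constant in the inner integral and
    comes out of it. *)
Lemma integrate_out_fubini (phi : R -> R) :
  measurable_fun setT phi -> (forall x, 0 <= phi x) ->
  (\int[lebesgue_tuple n.+1]_(u in @cube_tuple R n.+1)
      (c (row_of_tuple u) * phi (row_of_tuple u ord0 m))%:E =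
   \int[mu]_(x in `[0%R, 1%R]) (integrate_out c m x * phi x)%:E)%E.
Proof.
move=> mphi phi0.
rewrite (cube_fubini m (F := fun t => (c t * phi (t ord0 m))%:E)); first last.
- by move=> t tc; rewrite lee_fin mulr_ge0// ltW// c0.
- apply/measurable_EFinP; apply: measurable_funM.
    exact: measurable_cube_continuous.
  apply: measurable_funTS; exact: (measurableT_comp mphi (measurable_row_coord m)).
apply: eq_integral => x /set_mem /= x01.
under eq_integral do rewrite insert_coord_same EFinM muleC.
rewrite ge0_integralZl//; first by rewrite -integrate_outE// muleC.
- exact: measurable_cube_tuple.
- by case/integrableP: (integrable_insert_coord x01).
- by move=> v vc; rewrite lee_fin ltW// c0//; exact/cube_insert_coord.
- by rewrite lee_fin.
Qed.

End integrate_out.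

End cube_integrals.

(** * Real powers and integrals over segments *)

Lemma within_continuous_comp (R : realType) (T U : pseudoMetricType R)
    (A : set T) (B : set U) (f : T -> U) (g : U -> R) :
  (forall x, A x -> B (f x)) -> {within A, continuous f} ->
  {within B, continuous g} -> {within A, continuous (g \o f)}.
Proof.
move=> AB /subspace_continuousP cf /within_continuousP cg.
apply/within_continuousP => x Ax e e0.
have [d d0 H] := cg _ (AB _ Ax) _ e0.
have := cf _ Ax (ball (f x) d) (nbhsx_ballx _ _ d0).
rewrite /nbhs/= /within/= => /nbhs_ballP[d' /= d'0 H'].
exists d' => // y Ay xy; apply: H; [exact: AB|exact: H'].
Qed.

Lemma within_continuousM (R : realType) (T : topologicalType) (A : set T)
    (f g : T -> R) : {within A, continuous f} -> {within A, continuous g} ->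
  {within A, continuous (fun x => f x * g x)}.
Proof.
move=> /subspace_continuousP cf /subspace_continuousP cg.
by apply/subspace_continuousP => x Ax; apply: cvgM; [exact: cf|exact: cg].
Qed.

Lemma within_continuous_cst (R : realType) (T : topologicalType) (A : set T)
  (r : R) : {within A, continuous (fun _ : T => r)}.
Proof. by apply/subspace_continuousP => x Ax; exact: cvg_cst. Qed.

Section powR_facts.
Context {R : realType}.

Lemma powRS (y q : R) : 0 < y -> y `^ (q + 1) = y `^ q * y.
Proof. by move=> y0; rewrite powRD ?powRr1 ?(ltW y0)//; rewrite (gt_eqF y0) implybT. Qed.

(** Only continuity on the nonnegative axis holds: [x `^ p] is 1 for [x < 0]. *)
Lemma powR_within_continuous (p : R) : 0 < p ->
  {within [set x : R | 0 <= x], continuous (@powR R ^~ p)}.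
Proof.
move=> p0; apply/within_continuousP => x /=; rewrite le_eqVlt => /predU1P[<-|x0] e e0.
  exists (e `^ p^-1); first exact: powR_gt0.
  move=> y /= y0 yd; rewrite powR0 ?gt_eqF// sub0r normrN ger0_norm ?powR_ge0//.
  move: yd; rewrite /ball/= sub0r normrN ger0_norm// => yd.
  have := gt0_ltr_powR p0 (y0 : y \in Num.nneg) (powR_ge0 _ _ : _ \in Num.nneg) yd.
  by rewrite -powRrM mulVf ?gt_eqF// powRr1// ltW.
have dx : derivable (@powR R ^~ p) x 1.
  by apply: derivable_powR; rewrite in_itv/= x0.
have /derivable1_diffP/differentiable_continuous := dx.
move=> /cvgrPdist_lt/(_ _ e0)/nbhs_ballP[d /= d0 H].
by exists d => // y _; exact: H.
Qed.

Lemma powR_comp_continuous (A : set R) (f : R -> R) (p : R) : 0 < p ->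
  (forall x, A x -> 0 <= f x) -> {within A, continuous f} ->
  {within A, continuous (fun x => f x `^ p)}.
Proof.
move=> p0 f0 cf.
exact: (within_continuous_comp (f := f : R -> R)
  (B := [set x : R | 0 <= x]) f0 cf (powR_within_continuous p0)).
Qed.

Lemma powRN_comp_continuous (A : set R) (f : R -> R) (p : R) : 0 < p ->
  (forall x, A x -> 0 < f x) -> {within A, continuous f} ->
  {within A, continuous (fun x => f x `^ (- p))}.
Proof.
move=> p0 f0 cf.
have f0' x : A x -> 0 <= f x by move/f0/ltW.
have /subspace_continuousP cp := powR_comp_continuous p0 f0' cf.
rewrite (_ : (fun x => f x `^ (- p)) = (fun x => (f x `^ p)^-1)); last first.
  by apply/funext => y; rewrite powRN.
apply/subspace_continuousP => x Ax; apply: cvgV; last exact: cp.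
by rewrite gt_eqF// powR_gt0// f0.
Qed.

End powR_facts.

Section segments.
Context {R : realType}.
Local Notation mu := (@lebesgue_measure R).
Implicit Types (a b x : R) (f g : R -> R).

Lemma segment_integrable a b f : {within `[a, b], continuous f} ->
  mu.-integrable `[a, b] (EFin \o f).
Proof. by move=> cf; apply: continuous_compact_integrable => //; exact: segment_compact. Qed.

Lemma segment_EFin a b f : {within `[a, b], continuous f} ->
  (\int[mu]_(x in `[a, b]) (f x)%:E)%E = (\int[mu]_(x in `[a, b]) f x)%:E.
Proof.
move=> cf; rewrite /Rintegral fineK//; apply: integrable_fin_num => //.
exact: segment_integrable.
Qed.

Lemma segment_le a b f g :
  {within `[a, b], continuous f} -> {within `[a, b], continuous g} ->
  {in `[a, b], forall x, f x <= g x} ->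
  \int[mu]_(x in `[a, b]) f x <= \int[mu]_(x in `[a, b]) g x.
Proof.
move=> cf cg fg; apply: le_Rintegral => //; exact: segment_integrable.
Qed.

Lemma segment_cst a b (r : R) : a <= b -> \int[mu]_(x in `[a, b]) r = r * (b - a).
Proof.
move=> ab; have mab : mu `[a, b]%classic = (b - a)%:E.
  rewrite lebesgue_measure_itv/= lte_fin.
  by move: ab; rewrite le_eqVlt => /predU1P[->|->//]; rewrite ltxx subrr.
by rewrite Rintegral_cst// [X in fine X]mab.
Qed.

Lemma segment_ge_cst a b f (r : R) : a <= b -> {within `[a, b], continuous f} ->
  {in `[a, b], forall x, r <= f x} -> r * (b - a) <= \int[mu]_(x in `[a, b]) f x.
Proof.
move=> ab cf H; rewrite -segment_cst//; apply: segment_le => // x; exact: cvg_cst.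
Qed.

Lemma segment_split a b x f : x \in `[a, b] -> {within `[a, b], continuous f} ->
  \int[mu]_(t in `[a, b]) f t =
  \int[mu]_(t in `[a, x]) f t + \int[mu]_(t in `[x, b]) f t.
Proof.
rewrite in_itv/= => /andP[ax xb] cf.
rewrite -(@Rintegral_itv_obnd_cbnd _ x); last first.
  apply: integrableS (segment_integrable cf) => //.
  by apply: subset_itvScc; rewrite bnd_simp.
rewrite -(@Rintegral_itvB _ _ (BLeft a) (BRight b)) ?bnd_simp//; last exact: segment_integrable.
by rewrite addrC subrK.
Qed.

Lemma subsegment_continuous a b x y f : a <= x -> y <= b ->
  {within `[a, b], continuous f} -> {within `[x, y], continuous f}.
Proof.
move=> ax yb; apply: continuous_subspaceW => z /=; rewrite !in_itv/= => /andP[xz zy].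
by rewrite (le_trans ax) ?(le_trans zy).
Qed.

End segments.

(** * Knots of a regular sequence *)

Section knots.
Context {R : realType}.
Local Notation mu := (@lebesgue_measure R).
Variable h : R -> R.
Hypothesis hd : positive_continuous_density h.

Let ch : {within `[0, 1], continuous h}. Proof. by case: hd => -[]. Qed.
Let h0 x : x \in `[0, 1] -> 0 < h x. Proof. by case: hd => -[_ +] _; exact. Qed.

(** Existence of the knots, by the intermediate value theorem for the
    distribution function of [h]; their defining property is then that of
    [xget]. *)
Lemma rs_knotP n i : (0 < n)%N -> (i <= n)%N ->
  rs_knot h n i \in `[0, 1] /\
  \int[mu]_(v in `[0, rs_knot h n i]) h v = i%:R / n%:R.
Proof.
move=> n0 lein.
have [c c01 Hc] : exists2 c, c \in `[0, 1] &
    parameterized_integral mu 0 c h = i%:R / n%:R.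
  apply: IVT => //.
    by apply: parameterized_integral_continuous => //; exact: segment_integrable.
  rewrite {1 3}/parameterized_integral set_itv1 Rintegral_set1.
  rewrite (_ : parameterized_integral _ _ _ _ = 1); last by case: hd.
  rewrite minEle maxEle ler01 divr_ge0//= ler_pdivrMr ?ltr0n// mul1r ler_nat.
  by [].
exact: (@xgetPex _ 0 [set x | x \in `[0, 1] /\ _] (ex_intro _ c (conj c01 Hc))).
Qed.

Lemma density_length_le a b m : 0 <= a -> a <= b -> b <= 1 ->
  {in `[a, b], forall x, m <= h x} -> m * (b - a) <= \int[mu]_(x in `[a, b]) h x.
Proof.
by move=> a0 ab b1 H; apply: segment_ge_cst => //; exact: subsegment_continuous ch.
Qed.

Lemma density_mass_gt0 a b : 0 <= a -> a < b -> b <= 1 ->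
  0 < \int[mu]_(x in `[a, b]) h x.
Proof.
move=> a0 ab b1; have h0' x : `[0, 1]%classic x -> 0 < h x by move=> ?; exact: h0.
have [m m0 H] := compact_lower_bound (@segment_compact R 0 1) ch h0'.
apply: (@lt_le_trans _ _ (m * (b - a))); first by rewrite mulr_gt0// subr_gt0.
apply: density_length_le => //; first exact: ltW.
move=> x; rewrite in_itv/= => /andP[ax xb]; apply: H => /=.
by rewrite in_itv/= (le_trans a0 ax) (le_trans xb b1).
Qed.

Lemma density_mass_split a b : 0 <= a -> a <= b -> b <= 1 ->
  \int[mu]_(x in `[0, b]) h x =
  \int[mu]_(x in `[0, a]) h x + \int[mu]_(x in `[a, b]) h x.
Proof.
move=> a0 ab b1; apply: segment_split; first by rewrite in_itv/= a0.
exact: subsegment_continuous ch.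
Qed.

Lemma density_mass_lt a b : a \in `[0, 1] -> b \in `[0, 1] ->
  \int[mu]_(x in `[0, a]) h x < \int[mu]_(x in `[0, b]) h x -> a < b.
Proof.
rewrite !in_itv/= => /andP[a0 a1] /andP[b0 b1] H; rewrite ltNge; apply/negP => ba.
move: H; rewrite (density_mass_split b0 ba a1) ltNge lerDl.
by rewrite Rintegral_ge0// => x /=; rewrite in_itv/= => /andP[bx xa];
  rewrite ltW// h0// in_itv/= (le_trans b0 bx) (le_trans xa a1).
Qed.

Lemma rs_knot_lt n i : (i < n)%N -> rs_knot h n i < rs_knot h n i.+1.
Proof.
move=> lein; have n0 : (0 < n)%N by exact: leq_trans lein.
have [k0 Hk] := rs_knotP n0 (ltnW lein); have [k1 Hk1] := rs_knotP n0 lein.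
by apply: density_mass_lt => //; rewrite Hk Hk1 ltr_pM2r ?invr_gt0 ?ltr0n// ltr_nat.
Qed.

Lemma rs_knot_mass n i : (i < n)%N ->
  \int[mu]_(x in `[rs_knot h n i, rs_knot h n i.+1]) h x = n%:R^-1.
Proof.
move=> lein; have n0 : (0 < n)%N by exact: leq_trans lein.
have [k0 Hk] := rs_knotP n0 (ltnW lein); have [k1 Hk1] := rs_knotP n0 lein.
move: k0 k1; rewrite !in_itv/= => /andP[a0 a1] /andP[b0 b1].
have := density_mass_split a0 (ltW (rs_knot_lt lein)) b1.
rewrite Hk Hk1 -addn1 natrD mulrDl mul1r => /eqP.
by rewrite eq_sym (can2_eq (addKr _) (addNKr _)) addrA addrC addNr addr0 => /eqP.
Qed.

Lemma rs_knot_first n : (0 < n)%N -> rs_knot h n 0 = 0.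
Proof.
move=> n0; have [k0 Hk] := rs_knotP n0 (leq0n n).
move: k0; rewrite in_itv/= => /andP[]; rewrite le_eqVlt => /predU1P[//|a0 a1].
by have := density_mass_gt0 (lexx 0) a0 a1; rewrite Hk mul0r ltxx.
Qed.

Lemma rs_knot_last n : (0 < n)%N -> rs_knot h n n = 1.
Proof.
move=> n0; have [k0 Hk] := rs_knotP n0 (leqnn n).
move: k0; rewrite in_itv/= => /andP[a0]; rewrite le_eqVlt => /predU1P[//|a1].
have := density_mass_gt0 a0 a1 (lexx 1).
have := density_mass_split a0 (ltW a1) (lexx 1).
rewrite Hk divff ?gt_eqF ?ltr0n//; have -> : \int[mu]_(x in `[0, 1]) h x = 1 by case: hd.
by lra.
Qed.

Lemma rs_knot_cover n x : (0 < n)%N -> x \in `[0, 1] ->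
  exists2 i, (i < n)%N & rs_knot h n i <= x <= rs_knot h n i.+1.
Proof.
move=> n0; rewrite in_itv/= => /andP[x0 x1].
have ex : exists i, (i <= n)%N && (x <= rs_knot h n i).
  by exists n; rewrite leqnn rs_knot_last.
case: (ex_minnP ex) => -[|i] /andP[lein xi] imin.
  exists 0%N => //; rewrite rs_knot_first// x0/= (le_trans xi)// ltW//.
  exact: rs_knot_lt.
exists i => //; rewrite xi andbT leNgt; apply/negP => xi'.
by have := imin i; rewrite (ltnW lein) (ltW xi') ltnn => /(_ isT).
Qed.

(** A cell has mass [1 / n] and [h] is bounded below, so the cells shrink
    uniformly. *)
Lemma rs_knot_mesh (d : R) : 0 < d -> exists n0, forall n i,
  (n0 <= n)%N -> (i < n)%N -> rs_knot h n i.+1 - rs_knot h n i < d.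
Proof.
move=> d0; have h0' x : `[0, 1]%classic x -> 0 < h x by move=> ?; exact: h0.
have [m m0 H] := compact_lower_bound (@segment_compact R 0 1) ch h0'.
exists (Num.truncn (d * m)^-1).+1 => n i nn lein.
have n0 : (0 < n)%N by exact: leq_trans lein.
have [+ _] := rs_knotP n0 (ltnW lein); have [+ _] := rs_knotP n0 lein.
rewrite !in_itv/= => /andP[b0 b1] /andP[a0 a1].
have : m * (rs_knot h n i.+1 - rs_knot h n i) <= n%:R^-1.
  rewrite -(rs_knot_mass lein); apply: density_length_le => //.
    exact/ltW/rs_knot_lt.
  move=> x; rewrite in_itv/= => /andP[ax xb]; apply: H => /=.
  by rewrite in_itv/= (le_trans a0 ax) (le_trans xb b1).
move=> /le_lt_trans H1; rewrite -(ltr_pM2l m0); apply: H1.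
rewrite mulrC invf_plt ?posrE ?mulr_gt0 ?ltr0n//.
by rewrite (lt_le_trans (truncnS_gt _))// ler_nat.
Qed.

End knots.

(** * The two-point moment *)

Section two_point.
Context {R : realType}.
Local Notation mu := (@lebesgue_measure R).
Variable p : R.
Hypothesis p0 : 0 < p.

(** The mean of [|a + (b - a) * eta - x| ^ p] for a Bernoulli variable [eta]
    such that [a + (b - a) * eta] has mean [x]. *)
Definition two_point_moment (a b x : R) : R :=
  ((b - x) * (x - a) `^ p + (x - a) * (b - x) `^ p) / (b - a).

Lemma two_point_moment_ge0 a b x : a <= x <= b -> 0 <= two_point_moment a b x.
Proof.
move=> /andP[ax xb]; rewrite /two_point_moment divr_ge0 ?subr_ge0 ?(le_trans ax)//.
by rewrite addr_ge0// mulr_ge0 ?powR_ge0// subr_ge0.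
Qed.

Lemma measurable_two_point_moment a b :
  measurable_fun setT (two_point_moment a b).
Proof.
have m1 : measurable_fun setT (fun x : R => x - a) by apply: measurable_funB.
have m2 : measurable_fun setT (fun x : R => b - x) by apply: measurable_funB.
apply: measurable_funM => //; apply: measurable_funD; apply: measurable_funM => //.
  exact: (measurableT_comp (measurable_powR p) m1).
exact: (measurableT_comp (measurable_powR p) m2).
Qed.

Lemma sub_continuous_within (A : set R) a : {within A, continuous (fun x : R => x - a)}.
Proof. by apply: continuous_subspaceT => x; apply: cvgB; [exact: cvg_id|exact: cvg_cst]. Qed.

Lemma rsub_continuous_within (A : set R) a : {within A, continuous (fun x : R => a - x)}.
Proof. by apply: continuous_subspaceT => x; apply: cvgB; [exact: cvg_cst|exact: cvg_id]. Qed.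

Lemma powR_sub_continuous a b (q : R) : 0 < q ->
  {within `[a, b], continuous (fun x => (x - a) `^ q)} /\
  {within `[a, b], continuous (fun x => (b - x) `^ q)}.
Proof.
move=> q0; split; apply: powR_comp_continuous => //.
- by move=> x /=; rewrite in_itv/= subr_ge0 => /andP[].
- exact: sub_continuous_within.
- by move=> x /=; rewrite in_itv/= subr_ge0 => /andP[].
- exact: rsub_continuous_within.
Qed.

Lemma two_point_moment_continuous a b :
  {within `[a, b], continuous (two_point_moment a b)}.
Proof.
have [c1 c2] := powR_sub_continuous a b p0.
have c3 := @sub_continuous_within `[a, b]%classic a.
have c4 := @rsub_continuous_within `[a, b]%classic b.
apply: within_continuousM; last exact: within_continuous_cst.
by apply: within_continuousD; apply: within_continuousM.
Qed.

(** Up to the factor [b - a], the integrand is the sum of two Beta integrands,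
    exchanged by the reflection of [[a, b]], and has an explicit primitive. *)
Lemma integral_two_point_moment a b : a < b ->
  \int[mu]_(x in `[a, b]) two_point_moment a b x =
  2 / ((p + 1) * (p + 2)) * (b - a) `^ (p + 1).
Proof.
move=> ab; have ba : 0 < b - a by rewrite subr_gt0.
have p1 : 0 < p + 1 by rewrite addr_gt0.
have p2 : 0 < p + 2 by rewrite addr_gt0.
(* The primitive is the difference of two mirror images of one another. *)
pose F x := (((b - a) / (p + 1)) * (x - a) `^ (p + 1) - (p + 2)^-1 * (x - a) `^ (p + 2)
  - (((b - a) / (p + 1)) * (b - x) `^ (p + 1) - (p + 2)^-1 * (b - x) `^ (p + 2))) / (b - a).
have [c11 c12] := powR_sub_continuous a b p1.
have [c21 c22] := powR_sub_continuous a b p2.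
have cF : {within `[a, b], continuous F}.
  apply: within_continuousM; last exact: within_continuous_cst.
  by apply: within_continuousB; apply: within_continuousB;
    apply: within_continuousM => //; exact: within_continuous_cst.
have [cF1 cF2 cF3] := (continuous_within_itvP _ ab).1 cF.
have dF x : x \in `]a, b[ -> is_derive x 1 F (two_point_moment a b x).
  rewrite in_itv/= => /andP[ax xb].
  have xa0 : 0 < x - a by rewrite subr_gt0.
  have bx0 : 0 < b - x by rewrite subr_gt0.
  have d1 q : is_derive x 1 (fun x => (x - a) `^ q) (q * (x - a) `^ (q - 1)).
    have di : is_derive x 1 (fun y : R => y - a) (1 - 0) by exact: is_deriveB.
    have := @is_derive1_comp _ (@powR R ^~ q) (fun y => y - a) x _ _ (is_derive1_powR q xa0) di.
    by rewrite subr0 mulr1.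
  have d2 q : is_derive x 1 (fun x => (b - x) `^ q) (- (q * (b - x) `^ (q - 1))).
    have di : is_derive x 1 (fun y : R => b - y) (0 - 1) by exact: is_deriveB.
    have := @is_derive1_comp _ (@powR R ^~ q) (fun y => b - y) x _ _ (is_derive1_powR q bx0) di.
    by rewrite sub0r mulrN1.
  have e1 : p + 1 - 1 = p by ring.
  have e2 : p + 2 - 1 = p + 1 by ring.
  have := d1 (p + 1); rewrite e1 => d11; have := d1 (p + 2); rewrite e2 => d12.
  have := d2 (p + 1); rewrite e1 => d21; have := d2 (p + 2); rewrite e2 => d22.
  rewrite /F; apply: is_derive_eq.
  rewrite scaler0 add0r /GRing.scale/= /two_point_moment !powRS//.
  by field; rewrite !gt_eqF.
have H := continuous_FTC2 ab (@two_point_moment_continuous a b) (F := F).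
rewrite /Rintegral H/=.
- have -> : p + 2 = p + 1 + 1 by ring.
  rewrite /F !subrr !powR0 ?gt_eqF// (_ : p + 2 = p + 1 + 1); last by ring.
  by rewrite !powRS//; field; rewrite !gt_eqF//; lra.
- by split => // x xab; have [] := dF x xab.
- by move=> x xab; rewrite derive1E; have [_ ->] := dF x xab.
Qed.

End two_point.

(** * Sums of two-point moments over the cells *)

Section cell_moment.
Context {R : realType}.
Local Notation mu := (@lebesgue_measure R).
Variable p : R.
Hypothesis p0 : 0 < p.

(** The two-point moment of the cell that contains [x], written as a sum over all
    the cells.  A knot belongs to two cells, but there both two-point moments
    vanish; for the upper bounds it is enough that the terms are nonnegative. *)
Definition cell_moment (tau : nat -> R) (n : nat) (x : R) : R :=
  \sum_(i < n) \1_(`[tau i, tau i.+1]%classic) x * two_point_moment p (tau i) (tau i.+1) x.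

Let cell_ge0 (tau : nat -> R) i x :
  0 <= \1_(`[tau i, tau i.+1]%classic) x * two_point_moment p (tau i) (tau i.+1) x.
Proof.
rewrite indicE; have [/set_mem /=|_] := boolP (x \in _); last by rewrite mul0r.
by rewrite in_itv/= mul1r => ?; exact: two_point_moment_ge0.
Qed.

Lemma cell_moment_ge0 tau n x : 0 <= cell_moment tau n x.
Proof. by apply: sumr_ge0 => i _; exact: cell_ge0. Qed.

Lemma measurable_cell (tau : nat -> R) i : measurable_fun setT
  (fun x : R => \1_(`[tau i, tau i.+1]%classic) x * two_point_moment p (tau i) (tau i.+1) x).
Proof.
apply: measurable_funM; last exact: measurable_two_point_moment.
by apply: measurable_indic; exact: measurable_itv.
Qed.

Lemma measurable_cell_moment tau n : measurable_fun setT (cell_moment tau n).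
Proof. by apply: measurable_sum => i; exact: measurable_cell. Qed.

Lemma cell_moment_ge tau n i x : (i < n)%N -> tau i <= x <= tau i.+1 ->
  two_point_moment p (tau i) (tau i.+1) x <= cell_moment tau n x.
Proof.
move=> lein xi; rewrite /cell_moment (bigD1 (Ordinal lein))//=.
rewrite indicE mem_set ?mul1r/= ?in_itv//= lerDl.
by apply: sumr_ge0 => j _; exact: cell_ge0.
Qed.

Variables h C : R -> R.
Hypotheses (hd : positive_continuous_density h) (Cp : positive_continuous01 C).

Let ch : {within `[0, 1], continuous h}. Proof. by case: hd => -[]. Qed.
Let h0 x : `[0, 1]%classic x -> 0 < h x. Proof. by case: hd => -[_ +] _; exact. Qed.
Let cC : {within `[0, 1], continuous C}. Proof. by case: Cp. Qed.
Let C0 x : `[0, 1]%classic x -> 0 < C x. Proof. by case: Cp => _; exact. Qed.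

Lemma weight_continuous : {within `[0, 1], continuous (fun x => C x * h x `^ (- p))}.
Proof. by apply: within_continuousM => //; exact: powRN_comp_continuous. Qed.

Lemma weight_gt0 x : `[0, 1]%classic x -> 0 < C x * h x `^ (- p).
Proof. by move=> x01; rewrite mulr_gt0 ?C0// powR_gt0// h0. Qed.

(** On a small cell [[a, b]], whose mass under [h] is [1 / n], the length is at
    most [(1 + eta) / (n h y)] for every [y] of the cell, while [C] varies by a
    factor [1 + eta] at most.  This bounds the integral on the left by a constant
    times [(b - a) * C y * h y ^ (- p)], for every [y]; averaging over [y] gives
    the integral on the right. *)
Lemma cell_asymptotics (e : R) : 0 < e -> exists n0, forall n i,
  (n0 <= n)%N -> (i < n)%N ->
  \int[mu]_(x in `[rs_knot h n i, rs_knot h n i.+1])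
    (C x * two_point_moment p (rs_knot h n i) (rs_knot h n i.+1) x) <=
  (1 + e) * (2 / ((p + 1) * (p + 2))) / n%:R `^ p *
    \int[mu]_(x in `[rs_knot h n i, rs_knot h n i.+1]) (C x * h x `^ (- p)).
Proof.
move=> e0.
(* One factor [1 + eta] is spent on [C], and its power [p] on the length. *)
pose eta := (1 + e) `^ (p + 1)^-1 - 1.
have p1 : 0 < p + 1 by rewrite addr_gt0.
have p2 : 0 < p + 2 by rewrite addr_gt0.
have eta0 : 0 < eta.
  have : 1 `^ (p + 1)^-1 < (1 + e) `^ (p + 1)^-1.
    by apply: gt0_ltr_powR; rewrite ?invr_gt0 ?nnegrE ?ltrDl// addr_ge0// ltW.
  by rewrite powR1 subr_gt0.
have etaE : (1 + eta) * (1 + eta) `^ p = 1 + e.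
  rewrite mulrC -powRS; last by rewrite addr_gt0.
  have e10 : 0 <= 1 + e by rewrite addr_ge0// ltW.
  have p1N : p + 1 != 0 by rewrite gt_eqF.
  by rewrite /eta addrC subrK -powRrM mulVf// powRr1.
clearbody eta.
have [d1 d10 H1] := compact_ratio (@segment_compact R 0 1) cC C0 eta0.
have [d2 d20 H2] := compact_ratio (@segment_compact R 0 1) ch h0 eta0.
have d120 : 0 < Num.min d1 d2 by rewrite lt_min d10.
have [n0 Hn] := rs_knot_mesh hd d120.
exists n0 => n i nn lein; set a := rs_knot h n i; set b := rs_knot h n i.+1.
have n_gt0 : (0 < n)%N by exact: leq_trans lein.
have ab : a < b by exact: rs_knot_lt.
have [+ _] := rs_knotP hd n_gt0 (ltnW lein); have [+ _] := rs_knotP hd n_gt0 lein.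
rewrite -/a -/b !in_itv/= => /andP[b0 b1] /andP[a0 a1].
have := Hn n i nn lein; rewrite -/a -/b lt_min => /andP[r1 r2].
have sub x : x \in `[a, b] -> `[0, 1]%classic x.
  by rewrite /= !in_itv/= => /andP[ax xb]; rewrite (le_trans a0 ax) (le_trans xb b1).
have dist x y (d : R) : b - a < d -> x \in `[a, b] -> y \in `[a, b] -> ball x d y.
  rewrite !in_itv/= => bad /andP[ax xb] /andP[ay yb].
  by rewrite /ball/= ltr_norml; lra.
have cs (f : R -> R) : {within `[0, 1], continuous f} -> {within `[a, b], continuous f}.
  exact: subsegment_continuous.
pose B := (1 + e) * (2 / ((p + 1) * (p + 2))) / n%:R `^ p.
set I := \int[mu]_(x in _) _.
have key y : y \in `[a, b] -> I / (b - a) <= B * (C y * h y `^ (- p)).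
  move=> yab; have Cy := C0 (sub _ yab); have hy := h0 (sub _ yab).
  have rn : b - a <= (1 + eta) / (n%:R * h y).
    have : h y / (1 + eta) * (b - a) <= n%:R^-1.
      rewrite -(rs_knot_mass hd lein) -/a -/b; apply: (density_length_le hd) => //.
        exact: ltW.
      move=> x xab; rewrite ler_pdivrMr ?addr_gt0// mulrC.
      exact: H2 (sub _ yab) (sub _ xab) (dist _ _ _ r2 yab xab).
    have n0' : 0 < n%:R :> R by rewrite ltr0n.
    have eta1 : 0 < 1 + eta by rewrite addr_gt0.
    rewrite ler_pdivlMr ?mulr_gt0// => H.
    have : h y / (1 + eta) * (b - a) * (n%:R * (1 + eta)) <= n%:R^-1 * (n%:R * (1 + eta)).
      by rewrite ler_pM2r// mulr_gt0.
    rewrite mulKf ?gt_eqF//; congr (_ <= _).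
    by field; rewrite gt_eqF.
  have Ile : I <= (1 + eta) * C y * (2 / ((p + 1) * (p + 2)) * (b - a) `^ (p + 1)).
    rewrite -(integral_two_point_moment p0 ab) -RintegralZl//; last first.
      by apply: segment_integrable; exact: two_point_moment_continuous.
    apply: segment_le.
    - by apply: within_continuousM; [exact: cs|exact: two_point_moment_continuous].
    - apply: within_continuousM; first exact: within_continuous_cst.
      exact: two_point_moment_continuous.
    move=> x xab; rewrite ler_wpM2r//.
      by apply: two_point_moment_ge0; move: xab; rewrite in_itv.
    exact: H1 (sub _ xab) (sub _ yab) (dist _ _ _ r1 xab yab).
  have ba0 : 0 < b - a by rewrite subr_gt0.
  rewrite ler_pdivrMr//; apply: (le_trans Ile).
  have rp : (b - a) `^ p <= (1 + eta) `^ p * (n%:R `^ p)^-1 * h y `^ (- p).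
    have l1 : (b - a) `^ p <= ((1 + eta) / (n%:R * h y)) `^ p.
      apply: ge0_ler_powR => //; rewrite ?nnegrE; try exact: ltW.
      by rewrite divr_ge0 ?mulr_ge0 ?ler0n ?addr_ge0//; exact: ltW.
    apply: (le_trans l1).
    have invp (z : R) : 0 < z -> z^-1 `^ p = (z `^ p)^-1.
      by move=> z0; rewrite -powR_inv1 ?ltW// -powRrM mulN1r powRN.
    have n0' : 0 < n%:R :> R by rewrite ltr0n.
    have eta1 : 0 <= 1 + eta by rewrite addr_ge0// ltW.
    rewrite powRN -!invp// invfM mulrA -!powRM// ?mulr_ge0 ?invr_ge0//; exact: ltW.
  rewrite powRS// /B -etaE.
  have -> : (1 + eta) * C y * (2 / ((p + 1) * (p + 2)) * ((b - a) `^ p * (b - a))) =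
      ((1 + eta) * C y * (2 / ((p + 1) * (p + 2))) * (b - a)) * (b - a) `^ p by ring.
  have -> : (1 + eta) * (1 + eta) `^ p * (2 / ((p + 1) * (p + 2))) / n%:R `^ p *
     (C y * h y `^ (- p)) * (b - a) = ((1 + eta) * C y * (2 / ((p + 1) * (p + 2))) * (b - a)) *
    ((1 + eta) `^ p * (n%:R `^ p)^-1 * h y `^ (- p)) by ring.
  rewrite ler_wpM2l// !mulr_ge0 ?invr_ge0 ?mulr_ge0// ?ltW//.
  by rewrite addr_gt0.
have ba0 : 0 < b - a by rewrite subr_gt0.
have -> : I = I / (b - a) * (b - a) by rewrite divfK// gt_eqF.
have cw := cs _ weight_continuous.
rewrite -RintegralZl//; last exact: segment_integrable.
apply: segment_ge_cst => //; first exact: ltW.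
by apply: within_continuousM => //; exact: within_continuous_cst.
Qed.

(** The cells tile [[0, 1]]: the first knot is 0 and the last one is 1. *)
Lemma rs_knot_integral_sum (f : R -> R) n : (0 < n)%N -> {within `[0, 1], continuous f} ->
  \sum_(i < n) \int[mu]_(x in `[rs_knot h n i, rs_knot h n i.+1]) f x =
  \int[mu]_(x in `[0, 1]) f x.
Proof.
move=> n0 cf.
suff H k : (k <= n)%N -> \sum_(i < k) \int[mu]_(x in `[rs_knot h n i, rs_knot h n i.+1]) f x
    = \int[mu]_(x in `[0, rs_knot h n k]) f x.
  by rewrite H// rs_knot_last.
elim: k => [_|k IH kn]; first by rewrite big_ord0 rs_knot_first// set_itv1 Rintegral_set1.
rewrite big_ord_recr/= IH ?(ltnW kn)//.
have [+ _] := rs_knotP hd n0 (ltnW kn); have [+ _] := rs_knotP hd n0 kn.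
rewrite !in_itv/= => /andP[b0 b1] /andP[a0 a1].
rewrite -segment_split//; first by rewrite in_itv/= a0 ltW// rs_knot_lt.
exact: subsegment_continuous cf.
Qed.

Lemma cell_moment_asymptotics (e : R) : 0 < e -> exists n0, forall n, (n0 <= n)%N ->
  (\int[mu]_(x in `[0%R, 1%R]) (C x * cell_moment (rs_knot h n) n x)%:E <=
  ((1 + e) * (2 / ((p + 1) * (p + 2))) / n%:R `^ p *
    unit_integral (fun x => C x * h x `^ (- p)))%:E)%E.
Proof.
move=> e0; have [n0 H] := cell_asymptotics e0.
exists n0.+1 => n nn; have n_gt0 : (0 < n)%N by exact: leq_ltn_trans nn.
rewrite /unit_integral -(rs_knot_integral_sum n_gt0 weight_continuous) mulr_sumr -sumEFin.
have -> : (\int[mu]_(x in `[0%R, 1%R]) (C x * cell_moment (rs_knot h n) n x)%:E =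
   \sum_(i < n) \int[mu]_(x in `[0%R, 1%R])
      (C x * (\1_(`[rs_knot h n i, rs_knot h n i.+1]%classic) x *
       two_point_moment p (rs_knot h n i) (rs_knot h n i.+1) x))%:E)%E.
  rewrite -ge0_integral_sum//; first last.
  - by move=> i x x01; rewrite lee_fin mulr_ge0 ?cell_ge0// ltW// C0.
  - move=> i; apply/measurable_EFinP; apply: measurable_funM.
      exact: subspace_continuous_measurable_fun.
    by apply: measurable_funTS; exact: measurable_cell.
  by apply: eq_integral => x _; rewrite sumEFin -mulr_sumr.
apply: lee_sum => i _.
set a := rs_knot h n i; set b := rs_knot h n i.+1.
have [+ _] := rs_knotP hd n_gt0 (ltnW (ltn_ord i)).
have [+ _] := rs_knotP hd n_gt0 (ltn_ord i).
rewrite -/a -/b !in_itv/= => /andP[b0 b1] /andP[a0 a1].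
have -> : (\int[mu]_(x in `[0%R, 1%R]) (C x * (\1_(`[a, b]%classic) x * two_point_moment p a b x))%:E
   = \int[mu]_(x in `[a, b]) (C x * two_point_moment p a b x)%:E)%E.
  rewrite integral_mkcond [RHS]integral_mkcond; apply: eq_integral => x _; rewrite !patchE.
  rewrite indicE; have [x01|/negP x01] := boolP (x \in `[0, 1]%classic);
    have [xab|xab] := boolP (x \in `[a, b]%classic).
  - by rewrite mul1r.
  - by rewrite mul0r mulr0.
  - exfalso; apply: x01; apply/mem_set => /=; move/set_mem: xab; rewrite /= !in_itv/=.
    by move=> /andP[ax xb]; rewrite (le_trans a0 ax) (le_trans xb b1).
  - by [].
rewrite segment_EFin; last first.
  apply: within_continuousM; last exact: two_point_moment_continuous.
  exact: subsegment_continuous cC.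
by rewrite lee_fin; apply: H => //; exact: ltnW.
Qed.

End cell_moment.

(** * Second moments and the convexity inequality *)

Section ge0_le_integral_nonmeasurable.
Context d (T : measurableType d) (R : realType) (mu : {measure set T -> \bar R}).
Import HBNNSimple.

(** The integral of a nonnegative function is a supremum over the simple functions
    below it, hence monotone whether or not the functions are measurable.  This
    spares a proof that the norm of the interpolation error is measurable in
    [t]. *)
Lemma ge0_le_integralW (D : set T) (f g : T -> \bar R) :
  (forall x, D x -> 0 <= f x)%E -> (forall x, D x -> f x <= g x)%E ->
  (\int[mu]_(x in D) f x <= \int[mu]_(x in D) g x)%E.
Proof.
move=> f0 fg; rewrite !ge0_integralE//; last first.
  by move=> x Dx; exact: le_trans (f0 x Dx) (fg x Dx).
apply: le_ereal_sup => _ [h /= hf <-]; exists h => // x.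
apply: le_trans (hf x) _; rewrite !patchE; case: ifPn => // /set_mem; exact: fg.
Qed.

End ge0_le_integral_nonmeasurable.

Section squared_norms.
Context {R : realType}.

Lemma poweR_half_sqr (x : \bar R) : (0 <= x)%E -> ((x `^ 2^-1) ^+ 2 = x)%E.
Proof.
case: x => [r|_|//]; last by rewrite poweRyr ?invr_eq0 ?pnatr_eq0.
rewrite lee_fin => r0; rewrite poweR_EFin -EFin_expe; congr EFin.
by rewrite -powR_mulrn ?powR_ge0// -powRrM mulVf ?powRr1// pnatr_eq0.
Qed.

Context {dO : measure_display} {Omega : measurableType dO} (P : probability Omega R).

Lemma rv_norm_sqr (xi : Omega -> R) :
  (rv_norm P xi ^+ 2 = \int[P]_w (xi w ^+ 2)%:E)%E.
Proof.
rewrite /rv_norm poweR_half_sqr; first by rewrite unlock.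
by rewrite unlock; apply: integral_ge0 => w _; rewrite lee_fin sqr_ge0.
Qed.

Lemma field_norm_sqr n (Y : 'rV[R]_n -> Omega -> R) :
  (field_norm P Y ^+ 2 = \int[lebesgue_tuple n]_(u in @cube_tuple R n)
     (rv_norm P (Y (row_of_tuple u)) ^+ 2))%E.
Proof.
rewrite /field_norm poweR_half_sqr//; apply: integral_ge0 => u _.
by rewrite rv_norm_sqr; apply: integral_ge0 => w _; rewrite lee_fin sqr_ge0.
Qed.

(** Jensen's inequality for the square: the difference of the two sides is the
    variance of [a - x i] under the weights [p]. *)
Lemma sqr_sub_mean_le (I : finType) (a : R) (x p : I -> R) :
  (forall i, 0 <= p i) -> \sum_i p i = 1 ->
  (a - \sum_i x i * p i) ^+ 2 <= \sum_i p i * (a - x i) ^+ 2.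
Proof.
move=> p0 p1; pose m := \sum_i p i * (a - x i).
have -> : a - \sum_i x i * p i = m.
  rewrite /m -[X in X - _]mul1r -p1 mulr_suml -sumrB.
  by apply: eq_bigr => i _; ring.
rewrite -subr_ge0 (_ : _ - _ = \sum_i p i * (a - x i - m) ^+ 2).
  by apply: sumr_ge0 => i _; rewrite mulr_ge0// sqr_ge0.
rewrite (_ : \sum_i p i * (a - x i - m) ^+ 2 =
  \sum_i (p i * (a - x i) ^+ 2 + (- (2 * m)) * (p i * (a - x i)) + m ^+ 2 * p i)).
  by rewrite !big_split/= -!mulr_sumr p1 -/m; ring.
by apply: eq_bigr => i _; ring.
Qed.

Lemma rv_norm_sub_mean_le (I : finType) (Y : Omega -> R) (Z : I -> Omega -> R)
    (p : I -> R) :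
  measurable_fun setT Y -> (forall i, measurable_fun setT (Z i)) ->
  (forall i, 0 <= p i) -> \sum_i p i = 1 ->
  (rv_norm P (fun w => (Y w - \sum_i Z i w * p i)%R) ^+ 2 <=
   \sum_i (p i)%:E * rv_norm P (fun w => (Z i w - Y w)%R) ^+ 2)%E.
Proof.
move=> mY mZ p0 p1; rewrite rv_norm_sqr.
have mS i : measurable_fun setT (fun w => (Z i w - Y w) ^+ 2).
  by apply: (measurable_funX 2); exact: measurable_funB.
have -> : (\sum_i (p i)%:E * rv_norm P (fun w => (Z i w - Y w)%R) ^+ 2 =
   \int[P]_w \sum_i (p i * (Z i w - Y w) ^+ 2)%:E)%E.
  rewrite ge0_integral_sum//; last 2 first.
  - by move=> i; apply/measurable_EFinP; apply: measurable_funM.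
  - by move=> i w _; rewrite lee_fin mulr_ge0// sqr_ge0.
  apply: eq_bigr => i _; rewrite rv_norm_sqr.
  under [RHS]eq_integral do rewrite EFinM.
  rewrite ge0_integralZl//; first exact/measurable_EFinP.
    by move=> w _; rewrite lee_fin sqr_ge0.
  by rewrite lee_fin.
apply: ge0_le_integralW => w _; first by rewrite lee_fin sqr_ge0.
rewrite sumEFin lee_fin (le_trans (sqr_sub_mean_le _ _ p0 p1))//.
by apply: ler_sum => i _; rewrite -sqrrN opprB.
Qed.

End squared_norms.

(** * Euclidean norms and Bernoulli weights *)

Section euclidean.
Context {R : realType}.

Lemma enorm_le n (v : 'rV[R]_n) (b : R) : 0 <= b ->
  (forall m, `|v ord0 m| <= b) -> enorm v <= Num.sqrt n%:R * b.
Proof.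
move=> b0 H; rewrite /enorm -[X in _ * X](@ger0_norm _ b)// -sqrtr_sqr -sqrtrM ?ler0n//.
rewrite ler_wsqrtr// -[n in n%:R]card_ord -sumr_const mulr_suml; apply: ler_sum => m _.
by rewrite mul1r -real_normK ?num_real// lerXn2r ?nnegrE// H.
Qed.

(** The norm is at most [Num.sqrt n] times the largest coordinate, whose power is
    one of the terms of the sum. *)
Lemma enorm_powR_le n (v : 'rV[R]_n) (p : R) : 0 < p -> (0 < n)%N ->
  enorm v `^ p <= n%:R `^ (p / 2) * \sum_m `|v ord0 m| `^ p.
Proof.
case: n v => [//|n] v p0 _.
pose m := [arg max_(i > ord0) `|v ord0 i|]%O.
have Hm i : `|v ord0 i| <= `|v ord0 m|.
  by rewrite /m; case: arg_maxP => // j _ /(_ i isT).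
have H := enorm_le (normr_ge0 (v ord0 m)) Hm.
have e0 : 0 <= enorm v by rewrite /enorm sqrtr_ge0.
apply: (@le_trans _ _ ((Num.sqrt n.+1%:R * `|v ord0 m|) `^ p)).
  by apply: ge0_ler_powR; rewrite ?nnegrE ?mulr_ge0 ?sqrtr_ge0// ltW.
rewrite powRM ?sqrtr_ge0// -powR12_sqrt ?ler0n// -powRrM [2^-1 * p]mulrC.
rewrite ler_wpM2l ?powR_ge0// (bigD1 m)//= lerDl; apply: sumr_ge0 => i _.
exact: powR_ge0.
Qed.

Lemma enorm_gt0 n (v : 'rV[R]_n) m : v ord0 m != 0 -> 0 < enorm v.
Proof.
move=> vm; rewrite /enorm sqrtr_gt0 (bigD1 m)//=.
rewrite ltr_pwDl ?exprn_even_gt0//; apply: sumr_ge0 => i _; exact: sqr_ge0.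
Qed.

(** The product weights are normalised in each coordinate, so a function of the
    coordinate [m] only sees its own weights. *)
Lemma bernoulli_marginal (I : finType) (s : I -> R) (g : bool -> R) (m : I) :
  \sum_(e : {ffun I -> bool})
     (\prod_i (s i ^+ e i * (1 - s i) ^+ (~~ e i))) * g (e m) =
  s m * g true + (1 - s m) * g false.
Proof.
pose F i (b : bool) := (s i ^+ b * (1 - s i) ^+ (~~ b)) * (if i == m then g b else 1).
transitivity (\sum_(e : {ffun I -> bool}) \prod_i F i (e i)).
  apply: eq_bigr => e _; rewrite /F [RHS]big_split/=; congr (_ * _).
  rewrite (bigD1 m)//= eqxx big1 ?mulr1// => i /negPf ->.
  by [].
rewrite -(bigA_distr_bigA F) (bigD1 m)//= [X in _ * X]big1 ?mulr1 => [|i /negPf im].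
  by rewrite big_bool /F eqxx /= !expr0 !expr1 mulr1 mul1r.
by rewrite big_bool /F im /= !expr0 !expr1 !mulr1 mul1r addrC subrK.
Qed.

Lemma bernoulli_total (I : finType) (s : I -> R) :
  \sum_(e : {ffun I -> bool}) \prod_i (s i ^+ e i * (1 - s i) ^+ (~~ e i)) = 1.
Proof.
rewrite -(bigA_distr_bigA (fun i (b : bool) => s i ^+ b * (1 - s i) ^+ (~~ b))).
by rewrite big1// => i _; rewrite big_bool /= !expr0 !expr1 mulr1 mul1r addrC subrK.
Qed.

End euclidean.

(** * Pointwise error of the interpolator *)

Section cells.
Context {R : realType} (d : nat) (T : 'I_d -> nat -> R) (n : 'I_d -> nat).

(** Cells that cover the cube make the set from which [cell_coords] is chosen
    nonempty. *)
Lemma cell_coordsP (t : 'rV[R]_d) :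
  (forall m i, (i < n m)%N -> T m i < T m i.+1) ->
  (forall m, exists2 i, (i < n m)%N & T m i <= t ord0 m <= T m i.+1) ->
  [/\ forall m, ((cell_coords T n t).1 m < n m)%N, cube (cell_coords T n t).2 &
   t = grid_point T (cell_coords T n t).1 +
     mulv (cell_side T (cell_coords T n t).1) (cell_coords T n t).2].
Proof.
move=> Tlt Tcov.
have [f Hf] : exists f : 'I_d -> nat, forall m,
    (f m < n m)%N /\ T m (f m) <= t ord0 m <= T m (f m).+1.
  apply: (fin_all_exists (U := fun=> nat)
    (P := fun m i => (i < n m)%N /\ T m i <= t ord0 m <= T m i.+1)) => m.
  by have [i] := Tcov m; exists i.
pose i := [ffun m => f m].
pose s : 'rV[R]_d := \row_m ((t ord0 m - T m (f m)) / (T m (f m).+1 - T m (f m))).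
have r0 m : 0 < T m (f m).+1 - T m (f m) by rewrite subr_gt0 Tlt//; case: (Hf m).
pose Q := [set p : {ffun 'I_d -> nat} * 'rV[R]_d | [/\ forall m, (p.1 m < n m)%N, cube p.2 &
    t = grid_point T p.1 + mulv (cell_side T p.1) p.2]].
suff Qp : exists p, Q p by exact: (xgetPex ([ffun=> 0%N], 0) Qp).
exists (i, s); split => /=.
- by move=> m; rewrite ffunE; case: (Hf m).
- move=> m; rewrite mxE in_itv01; have [_ /andP[l u]] := Hf m.
  by rewrite divr_ge0 ?subr_ge0 ?(ltW (r0 m))//= ?ler_pdivrMr// ?mul1r ?lerD2r// -subr_ge0 ltW.
- apply/rowP => m; rewrite !mxE !ffunE mulrC divfK ?gt_eqF//.
  by rewrite addrC subrK.
Qed.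

Lemma cell_corner (i : {ffun 'I_d -> nat}) (e : {ffun 'I_d -> bool}) m :
  (grid_point T i + mulv (cell_side T i) (\row_m0 (e m0)%:R)) ord0 m =
  if e m then T m (i m).+1 else T m (i m).
Proof.
rewrite !mxE !ffunE; case: (e m); first by rewrite mulr1 addrC subrK.
by rewrite mulr0 addr0.
Qed.

Lemma cell_point (i : {ffun 'I_d -> nat}) (s : 'rV[R]_d) m :
  (grid_point T i + mulv (cell_side T i) s) ord0 m =
  T m (i m) + (T m (i m).+1 - T m (i m)) * s ord0 m.
Proof. by rewrite !mxE !ffunE. Qed.

End cells.

Lemma ereal_ratio_le (R : realType) (x : \bar R) (S e : R) : 0 < S ->
  (`|x / S%:E - 1| < e%:E)%E -> (x <= ((1 + e) * S)%:E)%E.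
Proof.
move=> S0; case: x => [r||]; last by rewrite leNye.
- rewrite inver gt_eqF// -EFinM -EFinB abse_EFin lte_fin lee_fin => /ltW.
  by rewrite ler_norml => /andP[_]; rewrite lerBlDr addrC ler_pdivrMr.
- by rewrite inver gt_eqF// gt0_mulye ?lte_fin ?invr_gt0.
Qed.

Section pointwise_bound.
Context {R : realType} {dO : measure_display} {Omega : measurableType dO}.
Variables (P : probability Omega R) (k : nat) (l : 'I_k -> nat).
Hypothesis l_gt0 : forall j, (0 < l j)%N.
Variables (alpha : 'I_k -> R) (c : 'I_k -> 'rV[R]_(tdim l) -> R).
Hypothesis alpha0 : forall j, 0 < alpha j.
Variable X : 'rV[R]_(tdim l) -> Omega -> R.
Hypothesis (mX : forall t, cube t -> measurable_fun setT (X t)).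
Hypothesis (c0 : forall j t, cube t -> 0 < c j t).
Variables (h : 'I_k -> R -> R) (n : 'I_k -> nat).
Hypotheses (hd : forall j, positive_continuous_density (h j)) (n0 : forall j, (0 < n j)%N).
Variables (eps delta : R).
Hypotheses (eps0 : 0 < eps) (delta0 : 0 < delta).
Hypothesis (Xls : forall t s, cube t -> s != 0 -> cube (t + s) -> enorm s < delta ->
  (`| rv_norm P (fun w => (X (t + s) w - X t w)%R) ^+ 2
            / (\sum_j c j t * enorm (subvector s j) `^ alpha j)%R%:E - 1 |
         < eps%:E)%E).
Hypothesis mesh : forall j i, (i < n j)%N ->
  (Num.sqrt (tdim l)%:R + 1) * (rs_knot (h j) (n j) i.+1 - rs_knot (h j) (n j) i) < delta.

(** Local stationarity applies to distinct points only; for [u = t] the left-hand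
    side is 0. *)
Lemma increment_bound t u : cube t -> cube u -> enorm (u - t) < delta ->
  (rv_norm P (fun w => (X u w - X t w)%R) ^+ 2 <=
   ((1 + eps) * \sum_j c j t * ((l j)%:R `^ (alpha j / 2) *
      \sum_(m < l j) `|u ord0 (tagnat.Rank j m) - t ord0 (tagnat.Rank j m)| `^ alpha j))%:E)%E.
Proof.
move=> tc uc ut; have e1 : 0 <= 1 + eps by rewrite addr_ge0// ltW.
have [->|utn] := eqVneq u t.
  rewrite rv_norm_sqr (eq_integral (cst 0%E)) ?integral0 => [|w _]; last first.
    by rewrite subrr expr0n.
  rewrite lee_fin mulr_ge0//; apply: sumr_ge0 => j _.
  rewrite mulr_ge0 ?(ltW (c0 _ tc))// mulr_ge0 ?powR_ge0//; apply: sumr_ge0 => m _.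
  exact: powR_ge0.
set S := \sum_j c j t * enorm (subvector (u - t) j) `^ alpha j.
have S0 : 0 < S.
  have : u - t != 0 by rewrite subr_eq0.
  case/rV0Pn => i ui; rewrite /S (bigD1 (tagnat.sig1 i))//=.
  apply: ltr_pwDl; last first.
    by apply: sumr_ge0 => j _; rewrite mulr_ge0 ?powR_ge0// ltW// c0.
  rewrite mulr_gt0 ?c0// powR_gt0// (@enorm_gt0 _ _ _ (tagnat.sig2 i))// mxE.
  by rewrite tagnat.sig2K.
have := @Xls t (u - t); rewrite subr_eq0 (addrC t) subrK => /(_ tc utn uc ut).
move=> /(ereal_ratio_le S0)/le_trans; apply; rewrite lee_fin ler_pM2l ?addr_gt0//.
apply: ler_sum => j _; rewrite ler_wpM2l ?(ltW (c0 _ tc))//.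
apply: le_trans (enorm_powR_le _ (alpha0 j) (l_gt0 j)) _.
by rewrite ler_wpM2l ?powR_ge0//; apply: ler_sum => m _; rewrite !mxE.
Qed.

(** By convexity the error is at most the mean over the corners of the increments
    between [t] and a corner; in the bound on an increment each term depends on
    one coordinate of the corner, and its mean is a two-point moment. *)
Lemma mpli_pointwise_bound t : cube t ->
  (rv_norm P (fun w => (X t w - crs_mpli h n X t w)%R) ^+ 2 <=
   ((1 + eps) * \sum_j c j t * ((l j)%:R `^ (alpha j / 2) * \sum_(m < l j)
     cell_moment (alpha j) (rs_knot (h j) (n j)) (n j) (t ord0 (tagnat.Rank j m))))%:E)%E.
Proof.
move=> tc; rewrite /crs_mpli /mpli.
pose T := crs_knot (l := l) h n; rewrite -/T.
have [] := @cell_coordsP R _ T (fun m => n (block_of m)) t.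
- by move=> m i lei; exact: rs_knot_lt.
- by move=> m; apply: rs_knot_cover => //; exact: tc.
case: (cell_coords _ _ _) => i s /= lei sc tE.
pose u (e : {ffun 'I_(tdim l) -> bool}) := grid_point T i + mulv (cell_side T i) (\row_m (e m)%:R).
have T01 m j : (j <= n (block_of m))%N -> T m j \in `[0, 1].
  by move=> jn; have [] := rs_knotP (hd (block_of m)) (n0 (block_of m)) jn.
have uc e : cube (u e).
  by move=> m; rewrite /u cell_corner; case: (e m); apply: T01 => //; exact: ltnW.
pose p (e : {ffun 'I_(tdim l) -> bool}) := \prod_m (s ord0 m ^+ e m * (1 - s ord0 m) ^+ (~~ e m)).
have s01 m : 0 <= s ord0 m <= 1 by have := sc m; rewrite in_itv01.
have p0 e : 0 <= p e.
  apply: prodr_ge0 => m _; have /andP[s0 s1] := s01 m.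
  by rewrite mulr_ge0// exprn_ge0// subr_ge0.
have p1 : \sum_e p e = 1 by exact: bernoulli_total.
apply: le_trans (rv_norm_sub_mean_le P (mX tc) (fun e => mX (uc e)) p0 p1) _.
pose r m := T m (i m).+1 - T m (i m).
have r0 m : 0 < r m by rewrite subr_gt0; exact: rs_knot_lt.
have uEt e m : (u e) ord0 m - t ord0 m = r m * ((e m)%:R - s ord0 m).
  rewrite /u cell_corner tE cell_point -/(r m); case: (e m) => /=.
    by rewrite /r; ring.
  by rewrite -/(r m); ring.
have near_u e : enorm (u e - t) < delta.
  have q0 : 0 < Num.sqrt (tdim l)%:R + 1 :> R by rewrite ltr_wpDl// sqrtr_ge0.
  (* Adding 1 to the root keeps the inequality strict and avoids a zero divisor. *)
  pose b := delta / (Num.sqrt (tdim l)%:R + 1).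
  have b0 : 0 < b by rewrite divr_gt0.
  have bd : Num.sqrt (tdim l)%:R * b < delta.
    by rewrite mulrCA gtr_pMr// ltr_pdivrMr// mul1r ltrDl.
  apply: le_lt_trans bd; apply: enorm_le => [|m]; first exact: ltW.
  have -> : (u e - t) ord0 m = r m * ((e m)%:R - s ord0 m) by rewrite -uEt !mxE.
  have rb : r m <= b.
    by rewrite ltW// ltr_pdivlMr// mulrC; apply: (mesh (j := block_of m)).
  apply: le_trans rb; rewrite normrM gtr0_norm// ler_piMr ?(ltW (r0 m))//.
  have /andP[s0 s1] := s01 m; rewrite ler_norml; case: (e m) => /=; lra.
apply: (@le_trans _ _ (\sum_e ((p e) * ((1 + eps) * \sum_j c j t * ((l j)%:R `^ (alpha j / 2) *
      \sum_(m < l j) `|(u e) ord0 (tagnat.Rank j m) - t ord0 (tagnat.Rank j m)| `^ alpha j)))%:E)%E).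
  apply: lee_sum => e _; rewrite EFinM; apply: lee_wpmul2l; first by rewrite lee_fin.
  exact: increment_bound.
rewrite sumEFin lee_fin.
have -> : \sum_e p e * ((1 + eps) * \sum_j c j t * ((l j)%:R `^ (alpha j / 2) *
      \sum_(m < l j) `|(u e) ord0 (tagnat.Rank j m) - t ord0 (tagnat.Rank j m)| `^ alpha j))
  = (1 + eps) * \sum_j c j t * ((l j)%:R `^ (alpha j / 2) * \sum_(m < l j)
   \sum_e p e * `|(u e) ord0 (tagnat.Rank j m) - t ord0 (tagnat.Rank j m)| `^ alpha j).
  under eq_bigr do rewrite mulrCA mulr_sumr.
  rewrite -mulr_sumr exchange_big/=; congr (_ * _); apply: eq_bigr => j _.
  rewrite exchange_big/= !mulr_sumr; apply: eq_bigr => e _.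
  by rewrite -mulr_sumr; ring.
rewrite ler_wpM2l ?addr_ge0 ?(ltW eps0)//; apply: ler_sum => j _.
rewrite ler_wpM2l ?(ltW (c0 _ tc))//; rewrite ler_wpM2l ?powR_ge0//; apply: ler_sum => m _.
set q := tagnat.Rank j m.
have qj : block_of q = j by exact: tagnat.Rank1K.
have TE : T q = rs_knot (h j) (n j) by rewrite /T /crs_knot qj.
have iq : (i q < n j)%N by rewrite -qj.
have tq : t ord0 q = T q (i q) + r q * s ord0 q by rewrite tE cell_point.
have /andP[s0 s1] := s01 q.
have aq := alpha0 j.
have tcell : rs_knot (h j) (n j) (i q) <= t ord0 q <= rs_knot (h j) (n j) (i q).+1.
  rewrite -TE tq lerDl mulr_ge0 ?(ltW (r0 _))//=.
  by rewrite -lerBrDl -/(r q) ler_piMr// ltW.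
apply: le_trans (cell_moment_ge (alpha j) iq tcell).
rewrite -TE; under eq_bigr do rewrite uEt.
rewrite (bernoulli_marginal (fun m => s ord0 m)
  (fun b => `|r q * (b%:R - s ord0 q)| `^ alpha j) q).
rewrite sub0r mulrN normrN !ger0_norm ?mulr_ge0 ?(ltW (r0 q))// ?subr_ge0//.
rewrite /two_point_moment -/(r q) tq.
rewrite (_ : T q (i q).+1 - (T q (i q) + r q * s ord0 q) = r q * (1 - s ord0 q));
  last by rewrite /r; ring.
rewrite (_ : T q (i q) + r q * s ord0 q - T q (i q) = r q * s ord0 q); last by ring.
rewrite le_eqVlt; apply/orP; left; apply/eqP.
by field; rewrite gt_eqF.
Qed.

End pointwise_bound.

(** * The optimal density *)

Section optimal_density.
Context {R : realType}.
Local Notation mu := (@lebesgue_measure R).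

(** If [f] is positive at a point, it exceeds half of this value on a subinterval
    of positive length, which contributes to the integral. *)
Lemma continuous_integral0 (f : R -> R) : {within `[0, 1], continuous f} ->
  {in `[0, 1], forall x, 0 <= f x} -> unit_integral f = 0 ->
  {in `[0, 1], forall x, f x = 0}.
Proof.
have aux (u v w r : R) : u + (v + w) = 0 -> 0 <= w -> 0 <= u -> 0 < r -> r <= v -> False.
  by lra.
move=> cf f0 If x0 x01; apply/eqP; rewrite eq_le f0// andbT leNgt; apply/negP => fx0.
have [d d0 Hd] := (within_continuousP _ _).1 cf x0 x01 _ (divr_gt0 fx0 (@ltr0Sn R 1)).
move: (x01); rewrite in_itv/= => /andP[x00 x11].
pose a := Num.max 0 (x0 - d / 2); pose b := Num.min 1 (x0 + d / 2).
have a0 : 0 <= a by rewrite le_max lexx.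
have b1 : b <= 1 by rewrite ge_min lexx.
have ab : a < b.
  rewrite /a /b lt_min !gt_max ltr01/=; apply/andP; split; first lra.
  by apply/andP; split; lra.
have ge0 u v : 0 <= u -> v <= 1 -> 0 <= \int[mu]_(x in `[u, v]) f x.
  move=> u0 v1; apply: Rintegral_ge0 => x /=; rewrite in_itv/= => /andP[ux xv].
  by apply: f0; rewrite in_itv/= (le_trans u0 ux) (le_trans xv v1).
have ca u v : 0 <= u -> v <= 1 -> {within `[u, v], continuous f}.
  by move=> u0 v1; exact: subsegment_continuous cf.
have : f x0 / 2 * (b - a) <= \int[mu]_(x in `[a, b]) f x.
  apply: segment_ge_cst; [exact: ltW|exact: ca|move=> x; rewrite in_itv/= => /andP[ax xb]].
  have := Hd x _ _; rewrite /ball/= in_itv/= (le_trans a0 ax) (le_trans xb b1) => /(_ isT).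
  have : `|x0 - x| < d.
    move: ax xb; rewrite /a /b ge_max le_min => /andP[_ ?] /andP[_ ?].
    by rewrite ltr_norml; lra.
  by move=> H /(_ H); rewrite ltr_norml; lra.
have : 0 < f x0 / 2 * (b - a) by rewrite mulr_gt0 ?subr_gt0// divr_gt0.
have a1 : a <= 1 by rewrite (le_trans (ltW ab)).
have s1 : \int[mu]_(x in `[0, 1]) f x =
    \int[mu]_(x in `[0, a]) f x + \int[mu]_(x in `[a, 1]) f x.
  by apply: segment_split => //; rewrite in_itv/= a0.
have s2 : \int[mu]_(x in `[a, 1]) f x =
    \int[mu]_(x in `[a, b]) f x + \int[mu]_(x in `[b, 1]) f x.
  by apply: segment_split; [rewrite in_itv/= (ltW ab)|exact: ca].
have := ge0 0 a (lexx 0) a1; have := ge0 b 1 (le_trans a0 (ltW ab)) (lexx 1).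
move: If; rewrite /unit_integral s1 s2 => If w0 u0 r0 rv; exact: aux If w0 u0 r0 rv.
Qed.

Lemma unit_integral_gt0 (f : R -> R) : positive_continuous01 f -> 0 < unit_integral f.
Proof.
move=> [cf f0]; have f0' x : `[0, 1]%classic x -> 0 < f x by move=> ?; exact: f0.
have [m m0 H] := compact_lower_bound (@segment_compact R 0 1) cf f0'.
apply: lt_le_trans m0 _; rewrite -[m]mulr1 -[X in m * X](subr0 1).
by apply: segment_ge_cst.
Qed.

Lemma unit_integralZ (f : R -> R) (r : R) : {within `[0, 1], continuous f} ->
  unit_integral (fun x => r * f x) = r * unit_integral f.
Proof. by move=> cf; apply: RintegralZl => //; exact: segment_integrable. Qed.

Lemma unit_integralB (f g : R -> R) : {within `[0, 1], continuous f} ->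
  {within `[0, 1], continuous g} ->
  unit_integral (fun x => f x - g x) = unit_integral f - unit_integral g.
Proof. by move=> cf cg; apply: RintegralB => //; exact: segment_integrable. Qed.

Lemma eq_unit_integral (f g : R -> R) : {in `[0, 1], f =1 g} ->
  unit_integral f = unit_integral g.
Proof. by move=> fg; apply: eq_Rintegral => x /set_mem /fg. Qed.

Section tangent.
Variable p : R.
Hypothesis p0 : 0 < p.

(** Two linear bounds for the exponential: [y `^ (- p)] is [expR (- p * ln y)],
    at least [1 - p * ln y], and [ln y <= y - 1]. *)
Lemma powRN_tangent (y : R) : 0 < y -> 1 + p - p * y <= y `^ (- p).
Proof.
move=> y0; rewrite /powR gt_eqF//; apply: le_trans (expR_ge1Dx _).
have := expR_ge1Dx (ln y); rewrite lnK ?posrE// => H.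
have : p * (1 + ln y) <= p * y by rewrite ler_pM2l.
by lra.
Qed.

(** For [y] different from 1, the inequality [ln y < y - 1] is strict. *)
Lemma powRN_tangent_eq (y : R) : 0 < y -> y `^ (- p) = 1 + p - p * y -> y = 1.
Proof.
move=> y0; have [->//|y1] := eqVneq y 1.
rewrite /powR gt_eqF// => H; exfalso.
have ly : ln y != 0 by apply: contra y1; rewrite ln_eq0.
have := expR_gt1Dx ly; rewrite lnK ?posrE// => H1.
have : p * (1 + ln y) < p * y by rewrite ltr_pM2l.
have := expR_ge1Dx (- p * ln y); rewrite H; lra.
Qed.

End tangent.

Section optimum.
Variables (p : R) (C : R -> R).
Hypotheses (p0 : 0 < p) (Cp : positive_continuous01 C).
Let q : R := 1 / (1 + p).
Let M : R := unit_integral (fun x => C x `^ q).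
Let hs (x : R) : R := C x `^ q / M.

Let p1 : 0 < 1 + p. Proof. by rewrite addr_gt0. Qed.
Let q0 : 0 < q. Proof. by rewrite divr_gt0. Qed.

Lemma powR_positive_continuous01 (r : R) : 0 < r ->
  positive_continuous01 (fun x => C x `^ r).
Proof.
move=> r0; case: Cp => cC C0; split; last by move=> x x01; rewrite powR_gt0// C0.
by apply: powR_comp_continuous => // x x01; rewrite ltW// C0.
Qed.

Let M0 : 0 < M. Proof. exact/unit_integral_gt0/powR_positive_continuous01. Qed.

Let hs0 x : x \in `[0, 1] -> 0 < hs x.
Proof. by move=> x01; rewrite divr_gt0// powR_gt0//; case: Cp => _; exact. Qed.

Lemma optimal_density : positive_continuous_density hs.
Proof.
have [cq _] := powR_positive_continuous01 q0.
split; first split.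
- by apply: within_continuousM => //; exact: within_continuous_cst.
- exact: hs0.
- rewrite (@eq_unit_integral _ (fun x => M^-1 * C x `^ q)); last first.
    by move=> x _; rewrite mulrC.
  by rewrite unit_integralZ// -/M mulVf// gt_eqF.
Qed.

(** The exponent [q] is chosen to make [C] proportional to the power [1 + p] of the
    density. *)
Let CE x : x \in `[0, 1] -> C x = M `^ (1 + p) * hs x `^ (1 + p).
Proof.
move=> x01; have Cx : 0 < C x by case: Cp => _; exact.
rewrite -powRM ?ltW// ?hs0// mulrC divfK ?gt_eqF//.
by rewrite -powRrM /q mul1r mulVf ?gt_eqF// powRr1// ltW.
Qed.

Let weightE (g : R -> R) x : x \in `[0, 1] -> 0 < g x ->
  C x * g x `^ (- p) = M `^ (1 + p) * (hs x * (g x / hs x) `^ (- p)).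
Proof.
move=> x01 gx; have hx := hs0 x01; rewrite CE// -mulrA; congr (_ * _).
rewrite powRM ?ltW ?invr_gt0// -[(hs x)^-1]powR_inv1 ?ltW// -powRrM mulN1r opprK.
by rewrite addrC powRS//; ring.
Qed.

Lemma optimal_weight : unit_integral (fun x => C x * hs x `^ (- p)) = M `^ (1 + p).
Proof.
rewrite (@eq_unit_integral _ (fun x => M `^ (1 + p) * hs x)); last first.
  by move=> x x01; rewrite weightE ?hs0// divff ?gt_eqF ?hs0// powR1 mulr1.
by rewrite unit_integralZ; case: optimal_density => -[cs _] // ->; rewrite mulr1.
Qed.

Lemma optimal_gamma_norm : gamma_norm q C = M `^ (1 + p).
Proof. by rewrite /gamma_norm -/M /q div1r invrK. Qed.

Section compare.
Variable g : R -> R.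
Hypothesis gd : positive_continuous_density g.

(** The integrand for [g] minus its tangent bound; the integral of the latter is
    the same for all densities [g]. *)
Let gap x := C x * g x `^ (- p) - M `^ (1 + p) * ((1 + p) * hs x - p * g x).

Let gapE x : x \in `[0, 1] -> gap x = M `^ (1 + p) *
  (hs x * ((g x / hs x) `^ (- p) - (1 + p - p * (g x / hs x)))).
Proof.
move=> x01; have gx : 0 < g x by case: gd => -[_ +] _; exact.
have hx := hs0 x01.
by rewrite /gap weightE//; field; rewrite gt_eqF.
Qed.

Let gap_ge0 x : x \in `[0, 1] -> 0 <= gap x.
Proof.
move=> x01; have gx : 0 < g x by case: gd => -[_ +] _; exact.
rewrite gapE// mulr_ge0 ?powR_ge0// mulr_ge0 ?(ltW (hs0 _))// subr_ge0.
by apply: powRN_tangent => //; rewrite divr_gt0// hs0.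
Qed.

Let gap_continuous : {within `[0, 1], continuous gap}.
Proof.
case: gd => -[cg g0] _; case: optimal_density => -[cs _] _; case: (Cp) => cC _.
apply: within_continuousB.
  by apply: within_continuousM => //; exact: powRN_comp_continuous.
apply: within_continuousM; first exact: within_continuous_cst.
by apply: within_continuousB; apply: within_continuousM => //; exact: within_continuous_cst.
Qed.

Let gap_integral : unit_integral gap =
  unit_integral (fun x => C x * g x `^ (- p)) - M `^ (1 + p).
Proof.
case: gd => -[cg g0] g1; case: optimal_density => -[cs _] s1; case: (Cp) => cC _.
have c1 : {within `[0, 1], continuous (fun x => (1 + p) * hs x)}.
  by apply: within_continuousM => //; exact: within_continuous_cst.
have c2 : {within `[0, 1], continuous (fun x => p * g x)}.
  by apply: within_continuousM => //; exact: within_continuous_cst.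
have c3 := within_continuousB c1 c2.
rewrite unit_integralB; last 2 first.
- by apply: within_continuousM => //; exact: powRN_comp_continuous.
- by apply: within_continuousM => //; exact: within_continuous_cst.
rewrite unit_integralZ// unit_integralB// !unit_integralZ// s1 g1.
by congr (_ - _); ring.
Qed.

Lemma optimal_weight_le :
  M `^ (1 + p) <= unit_integral (fun x => C x * g x `^ (- p)).
Proof.
rewrite -subr_ge0 -gap_integral; apply: Rintegral_ge0 => x /= x01.
exact: gap_ge0.
Qed.

Lemma optimal_weight_unique :
  unit_integral (fun x => C x * g x `^ (- p)) = M `^ (1 + p) ->
  {in `[0, 1], g =1 hs}.
Proof.
move=> E x x01; have gx : 0 < g x by case: gd => -[_ +] _; exact.
have I0 : unit_integral gap = 0 by rewrite gap_integral E subrr.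
have := continuous_integral0 gap_continuous gap_ge0 I0 x01.
rewrite gapE// => /eqP; rewrite mulf_eq0 (gt_eqF (powR_gt0 _ M0)) /=.
rewrite mulf_eq0 (gt_eqF (hs0 x01)) /=.
rewrite subr_eq0 => /eqP.
move=> /(powRN_tangent_eq p0 (divr_gt0 gx (hs0 x01))).
have hx := hs0 x01; move=> /(congr1 ( *%R^~ (hs x))) /=.
by rewrite divfK ?mul1r// gt_eqF.
Qed.

End compare.
End optimum.
End optimal_density.

(** * Integrated error *)

(** Moving the inserted value from position [b] to position [a] permutes
    cyclically the coordinates between the two, and no others. *)
Lemma insert_coord_exchange (R : realType) d (B : {set 'I_d}) (a b : 'I_d) :
  (forall i : 'I_d, (minn a b <= i <= maxn a b)%N -> i \in B) ->
  exists2 sigma : {perm 'I_d}, perm_on B sigma &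
    forall (x : R) (u : 'rV[R]_d.-1),
      insert_coord a x u = col_perm sigma (insert_coord b x u).
Proof.
case: d => [|d] in B a b *; first by case: a.
move=> HB; exists (lift_perm a b (1%g : 'S_d)).
  apply/fintype.subsetP => i; rewrite inE => si; apply: HB.
  move: si; case: (unliftP a i) => [i' ->|->]; last by rewrite geq_minl leq_maxl.
  rewrite lift_perm_lift perm1 -val_eqE /= /bump geq_min leq_max.
  case: (leqP a i'); case: (leqP b i'); rewrite ?eqxx ?add0n ?add1n ?orbT ?andbT// => h1 h2 _.
    by rewrite leqW.
  by rewrite (ltnW h2).
move=> x u; apply/rowP => i; rewrite [RHS]mxE.
case: (unliftP a i) => [i' ->|->].
  by rewrite lift_perm_lift perm1 !insert_coord_lift.
by rewrite lift_perm_id !insert_coord_same.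
Qed.

(** The dimension [tdim l] is not syntactically a successor, hence this form of
    the results on [integrate_out]. *)
Section any_coordinate.
Context {R : realType}.
Local Notation mR := (measurableTypeR R).
Local Notation mu := (@lebesgue_measure R).
Variables (d : nat) (m : 'I_d) (c : 'rV[R]_d -> R).
Hypotheses (cc : {within @cube R d, continuous c}) (c0 : forall t, cube t -> 0 < c t).

Lemma integrate_out_positive_continuous : positive_continuous01 (integrate_out c m).
Proof.
case: d m c cc c0 => [[]//|n] i f cf f0; split; first exact: integrate_out_continuous.
by move=> x x01; exact: integrate_out_gt0.
Qed.

Lemma cube_integral_coord (phi : R -> R) :
  measurable_fun setT phi -> (forall x, 0 <= phi x) ->
  (\int[lebesgue_tuple d]_(u in @cube_tuple R d)
      (c (row_of_tuple u) * phi (row_of_tuple u ord0 m))%:E =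
   \int[mu]_(x in `[0%R, 1%R]) (integrate_out c m x * phi x)%:E)%E.
Proof. case: d m c cc c0 => [[]//|n] i f cf f0; exact: integrate_out_fubini. Qed.

Lemma integrate_out_exchange (B : {set 'I_d}) (b : 'I_d) (x : R) :
  (forall sigma : {perm 'I_d}, perm_on B sigma ->
     forall t, cube t -> c (col_perm sigma t) = c t) ->
  (forall i : 'I_d, (minn m b <= i <= maxn m b)%N -> i \in B) ->
  x \in `[0, 1] -> integrate_out c m x = integrate_out c b x.
Proof.
move=> cB HB x01; have [sigma sB E] := insert_coord_exchange R HB.
apply: eq_Rintegral => u /set_mem /= uc; rewrite E cB//.
move: uc; clear - x01; case: d b u => [[]//|n] b u uc.
exact/cube_insert_coord.
Qed.

End any_coordinate.

Lemma block_convex k (l : 'I_k -> nat) (j : 'I_k) (a b i : 'I_(tdim l)) :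
  block_of a = j -> block_of b = j -> (minn a b <= i <= maxn a b)%N ->
  i \in block l j.
Proof.
suff H (u v : 'I_(tdim l)) :
    block_of u = j -> block_of v = j -> (u <= i <= v)%N -> i \in block l j.
  by move=> aj bj; case: (leqP a b) => _; exact: H.
move=> uj vj /andP[ui iv]; rewrite inE.
have := @tagnat.le_sig1 k l u i ui; have := @tagnat.le_sig1 k l i v iv.
rewrite -/(block_of u) uj -/(block_of v) vj => l2 l1.
by apply/eqP/le_anti/andP; split.
Qed.

Section total_bound.
Context {R : realType} {dO : measure_display} {Omega : measurableType dO}.
Local Notation mR := (measurableTypeR R).
Local Notation mu := (@lebesgue_measure R).
Variables (P : probability Omega R) (k : nat) (l : 'I_k -> nat).
Hypothesis l_gt0 : forall j, (0 < l j)%N.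
Variables (alpha : 'I_k -> R) (c : 'I_k -> 'rV[R]_(tdim l) -> R).
Hypothesis alpha0 : forall j, 0 < alpha j.
Variable X : 'rV[R]_(tdim l) -> Omega -> R.
Hypothesis X_ls : locally_stationary P alpha c X.

Let cc j : {within @cube R (tdim l), continuous (c j)}.
Proof. by case: X_ls => _ /(_ j)[]. Qed.
Let c0 j t : cube t -> 0 < c j t.
Proof. by case: X_ls => _ /(_ j)[_ +] _ _; exact. Qed.

Lemma Cint_positive_continuous j : positive_continuous01 (Cint l_gt0 c j).
Proof. exact: (integrate_out_positive_continuous (last_coord l_gt0 j) (@cc j) (@c0 j)). Qed.

(** The integration variables are permuted too when the two positions are
    exchanged, but only inside block [j], where [c j] is symmetric: the two
    integrands agree pointwise. *)
Lemma integrate_out_block j (m : 'I_(l j)) x : x \in `[0, 1] ->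
  integrate_out (c j) (tagnat.Rank j m) x = Cint l_gt0 c j x.
Proof.
move=> x01; apply: (integrate_out_exchange (B := block l j)) => //.
  by case: X_ls => _ _ _ H; exact: H.
by move=> i; apply: block_convex; exact: tagnat.Rank1K.
Qed.

Lemma wfactorE j : wfactor l alpha j =
  (l j)%:R * (l j)%:R `^ (alpha j / 2) * (2 / ((alpha j + 1) * (alpha j + 2))).
Proof.
rewrite /wfactor /a_const subrK addrC powRS ?ltr0n// mulrC.
by rewrite [_ `^ _ * _]mulrC mulrC.
Qed.

Variable h : 'I_k -> R -> R.
Hypothesis hd : forall j, positive_continuous_density (h j).

Lemma w_coef_gt0 j : 0 < w_coef l_gt0 alpha c j (h j).
Proof.
have a1 : 0 < alpha j + 1 by rewrite addr_gt0.
have a2 : 0 < alpha j + 2 by rewrite addr_gt0.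
rewrite /w_coef wfactorE mulr_gt0//.
  by rewrite mulr_gt0 ?divr_gt0 ?mulr_gt0 ?powR_gt0 ?ltr0n.
apply: unit_integral_gt0; split.
  exact: (weight_continuous (alpha0 j) (hd j) (Cint_positive_continuous j)).
by move=> x x01; apply: (weight_gt0 (alpha j) (hd j) (Cint_positive_continuous j)).
Qed.

(** One factor [1 + eps] comes from local stationarity and one from the
    one-dimensional asymptotics.  The [l j] coordinates of block [j] contribute
    equally, which turns the factor [l j `^ (alpha j / 2)] of the Euclidean norm
    into [l j `^ (1 + alpha j / 2)]. *)
Lemma total_bound (eps : R) : 0 < eps -> exists n0 : nat,
  forall n : 'I_k -> nat, (forall j, (n0 <= n j)%N) -> (forall j, (0 < n j)%N) ->
  (field_norm P (fun t w => X t w - crs_mpli h n X t w)%R ^+ 2 <=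
   ((1 + eps) * (1 + eps) *
     \sum_j w_coef l_gt0 alpha c j (h j) / (n j)%:R `^ alpha j)%:E)%E.
Proof.
move=> eps0.
have [[sX _] _ /(_ eps eps0)[delta delta0 Xls] _] := X_ls.
have q0 : 0 < Num.sqrt (tdim l)%:R + 1 :> R by rewrite ltr_wpDl// sqrtr_ge0.
have [N1 HN1] : exists N1 : 'I_k -> nat, forall j n i, (N1 j <= n)%N -> (i < n)%N ->
   rs_knot (h j) n i.+1 - rs_knot (h j) n i < delta / (Num.sqrt (tdim l)%:R + 1).
  apply: (fin_all_exists (U := fun=> nat) (P := fun j N => forall n i,
    (N <= n)%N -> (i < n)%N ->
    rs_knot (h j) n i.+1 - rs_knot (h j) n i < delta / (Num.sqrt (tdim l)%:R + 1))) => j.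
  by apply: rs_knot_mesh => //; exact: divr_gt0.
pose bound j n := (\int[mu]_(x in `[0%R, 1%R])
    (Cint l_gt0 c j x * cell_moment (alpha j) (rs_knot (h j) n) n x)%:E <=
  ((1 + eps) * (2 / ((alpha j + 1) * (alpha j + 2))) / n%:R `^ alpha j *
    unit_integral (fun x => Cint l_gt0 c j x * h j x `^ (- alpha j)))%:E)%E.
have [N2 HN2] : exists N2 : 'I_k -> nat, forall j n, (N2 j <= n)%N -> bound j n.
  apply: (fin_all_exists (U := fun=> nat)
    (P := fun j N => forall n, (N <= n)%N -> bound j n)) => j.
  exact: (cell_moment_asymptotics (alpha0 j) (hd j) (Cint_positive_continuous j) eps0).
exists (\max_j maxn (N1 j) (N2 j))%N => n nn n0.
have n1 j : (N1 j <= n j)%N.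
  apply: leq_trans (nn j); apply: leq_trans (leq_bigmax j); exact: leq_maxl.
have n2 j : (N2 j <= n j)%N.
  apply: leq_trans (nn j); apply: leq_trans (leq_bigmax j); exact: leq_maxr.
have mesh j i : (i < n j)%N ->
  (Num.sqrt (tdim l)%:R + 1) * (rs_knot (h j) (n j) i.+1 - rs_knot (h j) (n j) i) < delta.
  by move=> lei; rewrite mulrC -ltr_pdivlMr//; exact: HN1.
rewrite field_norm_sqr.
pose phi j := cell_moment (alpha j) (rs_knot (h j) (n j)) (n j).
pose K j := (1 + eps) * (l j)%:R `^ (alpha j / 2).
have K0 j : 0 <= K j by rewrite mulr_ge0 ?powR_ge0// addr_ge0// ltW.
pose G j (m : 'I_(l j)) (t : 'rV[R]_(tdim l)) := c j t * phi j (t ord0 (tagnat.Rank j m)).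
have G0 j (m : 'I_(l j)) t : cube t -> 0 <= G j m t.
  by move=> tc; rewrite mulr_ge0 ?(ltW (c0 _ tc))// cell_moment_ge0.
have mG j (m : 'I_(l j)) : measurable_fun (@cube_tuple R (tdim l))
    (fun u => (G j m (row_of_tuple u))%:E).
  apply/measurable_EFinP; apply: measurable_funM.
    exact: measurable_cube_continuous.
  apply: measurable_funTS.
  exact: (measurableT_comp (measurable_cell_moment _ _ _) (measurable_row_coord _)).
apply: (@le_trans _ _ (\int[lebesgue_tuple (tdim l)]_(u in @cube_tuple R (tdim l))
   \sum_j \sum_(m < l j) ((K j)%:E * (G j m (row_of_tuple u))%:E))%E).
  apply: ge0_le_integralW => u uc.
    by rewrite rv_norm_sqr; apply: integral_ge0 => w _; rewrite lee_fin sqr_ge0.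
  apply: le_trans (mpli_pointwise_bound l_gt0 alpha0 _ c0 hd n0 eps0 delta0 Xls mesh uc) _.
    by move=> t /sX[].
  have -> : (\sum_j \sum_(m < l j) ((K j)%:E * (G j m (row_of_tuple u))%:E) =
      (\sum_j \sum_(m < l j) K j * G j m (row_of_tuple u))%R%:E)%E.
    rewrite -sumEFin; apply: eq_bigr => j _; rewrite -sumEFin.
    by apply: eq_bigr => m _; rewrite EFinM.
  rewrite lee_fin le_eqVlt; apply/orP; left; apply/eqP.
  rewrite mulr_sumr; apply: eq_bigr => j _; rewrite !mulr_sumr; apply: eq_bigr => m _.
  by rewrite /K /G /phi; ring.
rewrite ge0_integral_sum//; first last.
- move=> j u uc; apply: sume_ge0 => m _; rewrite mule_ge0 ?lee_fin//; exact: G0.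
- by move=> j; apply: emeasurable_sum => m; apply: measurable_funeM.
- exact: measurable_cube_tuple.
rewrite mulr_sumr -sumEFin; apply: lee_sum => j _.
rewrite ge0_integral_sum//; first last.
- by move=> m u uc; rewrite mule_ge0 ?lee_fin//; exact: G0.
- by move=> m; apply: measurable_funeM.
- exact: measurable_cube_tuple.
apply: (@le_trans _ _ (\sum_(m < l j) (K j * ((1 + eps) * (2 / ((alpha j + 1) * (alpha j + 2)))
   / (n j)%:R `^ alpha j * unit_integral (fun x => Cint l_gt0 c j x * h j x `^ (- alpha j))))%:E)%E).
  apply: lee_sum => m _; rewrite ge0_integralZl//; first last.
  - by rewrite lee_fin.
  - by move=> u uc; rewrite lee_fin; exact: G0.
  - exact: measurable_cube_tuple.
  rewrite [X in (_ <= X)%E]EFinM lee_wpmul2l ?lee_fin//; apply: le_trans (HN2 j _ (n2 j)).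
  rewrite (cube_integral_coord _ (@cc j) (@c0 j) (measurable_cell_moment _ _ _)
    (cell_moment_ge0 _ _ _)).
  rewrite le_eqVlt; apply/orP; left; apply/eqP; apply: eq_integral => x /set_mem x01.
  by rewrite integrate_out_block.
rewrite sumEFin lee_fin sumr_const card_ord /w_coef wfactorE /K -[X in X <= _]mulr_natl.
by rewrite le_eqVlt; apply/orP; left; apply/eqP; ring.
Qed.

End total_bound.

(** * Asymptotic comparison *)

Lemma asymp_leP (R : realType) (A : set nat) (u : nat -> \bar R) (v : nat -> R) :
  (forall N, A N -> 0 < v N) ->
  (forall e : R, 0 < e -> \forall N \near within A \oo, (u N <= ((1 + e) * v N)%:E)%E) ->
  asymp_le A u v.
Proof.
move=> v0 H; apply/lee_addgt0Pr => e e0.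
pose V := [set N | (u N / (v N)%:E <= (1 + e)%:E)%E].
apply: (@le_trans _ _ (ereal_sup [set (u N / (v N)%:E)%E | N in V])); last first.
  by apply: ge_ereal_sup => _ [N VN <-]; rewrite -EFinD.
apply: ereal_inf_lbound; exists V => //; move: (H _ e0); rewrite !near_withinE.
apply: filterS => N HN AN; rewrite /V /= inver gt_eqF ?v0// lee_pdivrMr ?v0//.
by rewrite -EFinM; exact: HN.
Qed.

Theorem proposition2 (R : realType) (dO : measure_display)
    (Omega : measurableType dO) (P : probability Omega R)
    (k : nat) (l : 'I_k -> nat) (l_gt0 : forall j, (0 < l j)%N)
    (alpha : 'I_k -> R) (alpha02 : forall j, 0 < alpha j < 2)
    (c : 'I_k -> 'rV[R]_(tdim l) -> R) (X : 'rV[R]_(tdim l) -> Omega -> R)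
    (X_ls : locally_stationary P alpha c X) :
  (forall (h : 'I_k -> R -> R) (A : set nat) (nn : nat -> 'I_k -> nat),
     (forall j, positive_continuous_density (h j)) ->
     design_sizes l A nn ->
     asymp_le A
       (fun N => (field_norm P (fun t w => X t w - crs_mpli h (nn N) X t w)%R ^+ 2)%E)
       (fun N => \sum_j w_coef l_gt0 alpha c j (h j) / (nn N j)%:R `^ alpha j)) /\
  (forall j : 'I_k,
     [/\ positive_continuous_density (h_subopt l_gt0 alpha c j),
         (forall g, positive_continuous_density g ->
            w_coef l_gt0 alpha c j (h_subopt l_gt0 alpha c j) <= w_coef l_gt0 alpha c j g),
         (forall g, positive_continuous_density g ->
            w_coef l_gt0 alpha c j g = w_coef l_gt0 alpha c j (h_subopt l_gt0 alpha c j) ->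
            {in `[0, 1], g =1 h_subopt l_gt0 alpha c j})
       & w_coef l_gt0 alpha c j (h_subopt l_gt0 alpha c j) = w_subopt l_gt0 alpha c j]).
Proof.
have alpha0 j : 0 < alpha j by case/andP: (alpha02 j).
split.
  move=> h A nn hd [Ainf Apos AN Aoo].
  have wc j := w_coef_gt0 l_gt0 alpha0 X_ls hd j.
  (* Without blocks every [N] would be 1, but infinitely many [N] occur. *)
  have j0 : 'I_k.
    case: k l {l_gt0 alpha alpha02 c X X_ls alpha0 h hd wc Apos Aoo} nn AN;
      last by move=> k' *; exact: ord0.
    move=> l' nn AN; exfalso; apply: Ainf; apply: (@sub_finite_set _ _ [set 1%N]); last exact: finite_set1.
    by move=> N /AN; rewrite big_ord0 => <-.
  apply: asymp_leP => [N /Apos[_ n0]|e e0].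
    have w0 j : 0 < w_coef l_gt0 alpha c j (h j) / (nn N j)%:R `^ alpha j.
      by rewrite divr_gt0// powR_gt0// ltr0n.
    by rewrite (bigD1 j0)//= ltr_pwDl// sumr_ge0// => j _; exact: ltW.
  (* With [eps <= 1] the square of [1 + eps] is at most [1 + 3 * eps]. *)
  pose eps := Num.min 1 (e / 3).
  have eps0 : 0 < eps by rewrite lt_min ltr01 divr_gt0.
  have epsE : (1 + eps) * (1 + eps) <= 1 + e.
    have h1 : eps <= 1 by rewrite ge_min lexx.
    have h2 : eps <= e / 3 by rewrite ge_min lexx orbT.
    have : eps * eps <= eps by rewrite ler_piMl// ltW.
    by lra.
  have [n0 H] := total_bound l_gt0 alpha0 X_ls hd eps0.
  have Hn : \forall N \near within A \oo, forall j, (n0 <= nn N j)%N.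
    by apply: filter_forall => j; exact: (Aoo j _ (nbhs_infty_ge n0)).
  move: Hn; rewrite !near_withinE; apply: filterS => N HN' AN'.
  have [_ npos] := Apos _ AN'.
  apply: le_trans (H _ (HN' AN') npos) _; rewrite lee_fin ler_wpM2r//.
  by apply: sumr_ge0 => j _; rewrite divr_ge0 ?powR_ge0// ltW.
move=> j; have a0 := alpha0 j.
have Cp := Cint_positive_continuous l_gt0 X_ls j.
have wf0 : 0 < wfactor l alpha j.
  rewrite wfactorE//; rewrite mulr_gt0 ?divr_gt0 ?mulr_gt0 ?powR_gt0 ?ltr0n//; lra.
split.
- exact: (optimal_density a0 Cp).
- move=> g gd; rewrite /w_coef ler_pM2l//.
  by rewrite (optimal_weight a0 Cp); exact: (optimal_weight_le a0 Cp gd).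
- move=> g gd /(mulfI (lt0r_neq0 wf0)); rewrite (optimal_weight a0 Cp).
  exact: (optimal_weight_unique a0 Cp gd).
- by rewrite /w_coef /w_subopt (optimal_weight a0 Cp) /gamma_exp optimal_gamma_norm.
Qed.
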